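(* Let $n,k\ge1$ and let $F=\langle f_1,\dots,f_k\rangle$ and $G=\langle g_1,\dots,g_k\rangle$ be two general sparse polynomial systems in $x_1,\dots,x_n$ (with possibly different supports) such that $\mathrm{Newt}(f_j)=\mathrm{Newt}(g_j)$ for every $j\in\{1,\dots,k\}$. Then the ML degree of $F$ equals the ML degree of $G$.
   Context: A sparse polynomial system with support $(\mathcal{A}_1,\dots,\mathcal{A}_k)$, where each $\mathcal{A}_j\subset\mathbb{Z}_{\ge0}^n$ is finite and nonempty, is $F=\langle f_1,\dots,f_k\rangle$ with $f_j=\sum_{\alpha\in\mathcal{A}_j}c_{j,\alpha}x^\alpha$, $x^\alpha=x_1^{\alpha_1}\cdots x_n^{\alpha_n}$. For a data vector $u=(u_1,\dots,u_n)$ the ML system of $F$ is the system $$\mathcal{L}(F)=\langle \ell_1,\dots,\ell_n,f_1,\dots,f_k\rangle,\qquad \ell_i=u_i-x_i\sum_{j=1}^k\lambda_j\frac{\partial f_j}{\partial x_i}\quad(i=1,\dots,n),$$ of $n+k$ polynomial equations (all set to zero) in the $n+k$ unknowns $x_1,\dots,x_n,\lambda_1,\dots,\lambda_k$. ''General'' for $F$ and $u$ means that the coefficients $(c_{j,\alpha})$ and the data $u$ lie in a suitable dense Zariski open subset of $\mathbb{C}^{|\mathcal{A}_1|+\dots+|\mathcal{A}_k|}\times\mathbb{C}^n$ depending only on the supports (and similarly for $G$ with its own supports). The ML degree of $F$ is the number of complex solutions $(x,\lambda)\in\mathbb{C}^n\times\mathbb{C}^k$ of $\mathcal{L}(F)$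 for general $u$. $\mathrm{Newt}(g)$ is the convex hull of the exponent vectors of the monomials appearing in $g$ with nonzero coefficient. *)

(* Defs.v *)
From HB Require Import structures.
From mathcomp Require Import all_boot all_order all_algebra.
From mathcomp Require Import finmap.
From mathcomp Require Import boolp classical_sets cardinality reals.
From mathcomp Require Export complex.
From mathcomp Require Export mpoly.

Set Implicit Arguments.
Unset Strict Implicit.
Unset Printing Implicit Defensive.

Import Order.TTheory GRing.Theory Num.Theory.
Local Open Scope ring_scope.
Local Open Scope classical_set_scope.

(* The affine space C^I, for a finite index set I, is {ffun I -> C}; a
   polynomial on it is a polynomial in #|I| variables, the variable of index l
   being the coordinate of index enum_val l. *)
Section Zariski.
Variables (C : fieldType) (I : finType).
Implicit Types (P : {mpoly C[#|I|]}) (p : {ffun I -> C}) (O : set {ffun I -> C}).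

Definition eval_at p P : C := P.@[fun l => p (enum_val l)].

Definition zero_locus (S : set {mpoly C[#|I|]}) : set {ffun I -> C} :=
  [set p | forall P, S P -> eval_at p P = 0].

Definition zariski_open O : Prop := exists S, O = ~` zero_locus S.

Definition zariski_dense O : Prop :=
  forall V : set {ffun I -> C}, zariski_open V -> V !=set0 -> (V `&` O) !=set0.

End Zariski.

Section Newton.
Variable R : realType.

Definition conv_hull (V : lmodType R) (E : set V) : set V :=
  [set y | exists (m : nat) (w : 'I_m -> R) (e : 'I_m -> V),
    [/\ forall i, 0 <= w i, \sum_i w i = 1, forall i, E (e i)
      & y = \sum_i w i *: e i]].

Definition exponent_vector (n : nat) (a : 'X_{1..n}) : 'rV[R]_n :=
  \row_i (a i)%:R.

Definition Newt (n : nat) (g : {mpoly R[i][n]}) : set 'rV[R]_n :=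
  conv_hull [set exponent_vector a | a in [set` msupp g]].

End Newton.

Section SparseSystems.
Variables (C : fieldType) (n k : nat).

Definition supports := 'I_k -> {fset 'X_{1..n}}.

(* Index set of the coefficients c_{j,a}, a in A_j: its cardinality is
   |A_1| + ... + |A_k|. *)
Definition coef_index (A : supports) : finType := {j : 'I_k & A j}.

(* C^(|A_1| + ... + |A_k|) x C^n is {ffun coef_index A + 'I_n -> C}. *)
Definition coefs_of (A : supports) (p : {ffun coef_index A + 'I_n -> C}) :
  {ffun coef_index A -> C} := [ffun t => p (inl t)].

Definition data_of (A : supports) (p : {ffun coef_index A + 'I_n -> C}) :
  {ffun 'I_n -> C} := [ffun i => p (inr i)].

Definition sparse_system (A : supports) (c : {ffun coef_index A -> C}) :
    'I_k -> {mpoly C[n]} :=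
  fun j => \sum_(a : A j) c (Tagged (fun j => A j) a) *: 'X_[val a].

Definition ML_solutions (f : 'I_k -> {mpoly C[n]}) (u : {ffun 'I_n -> C}) :
    set ({ffun 'I_n -> C} * {ffun 'I_k -> C}) :=
  [set xl : {ffun 'I_n -> C} * {ffun 'I_k -> C} |
     (forall i : 'I_n,
       u i - xl.1 i * \sum_(j < k) xl.2 j * ((f j)^`M(i)).@[xl.1] = 0) /\
     (forall j : 'I_k, (f j).@[xl.1] = 0)].

(* "For general u". The number m is unique, since two dense open sets of data
   always meet. *)
Definition is_ML_degree (f : 'I_k -> {mpoly C[n]}) (m : nat) : Prop :=
  exists W : set {ffun 'I_n -> C},
    [/\ zariski_open W, zariski_dense W
      & forall u, W u -> (ML_solutions f u #= `I_m)%card].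

End SparseSystems.

(* Main.v *)
(** For general coefficients and data the solutions of the ML system are
    nondegenerate, and they cannot leave the torus when the system is perturbed,
    even by new monomials inside the Newton polytopes.  Indeed, suppose that [x]
    escapes.  In each [f_j] the terms that dominate along the escape form a face
    system, whose logarithmic gradients at its zeros are linearly independent
    because the coefficients are general.  So the rescaled multipliers converge,
    and in the limit [u] is a combination of these gradients, all of which are
    orthogonal to some direction [w <> 0] orthogonal to the faces; but
    [<u, w> <> 0] for general [u].  Hence the number of solutions is locally
    constant, also at general points for the supports [A_j] or [B_j] seen inside
    the space of systems with supports [A_j \cup B_j], and two such points are
    joined by a path that meets the bad hypersurface at most at its ends.

    The genericity conditions are open and dense by the Jacobian criterion and a
    dimension count.  Limits are taken along a nonprincipal ultrafilter on [nat],
    which avoids extracting subsequences. *)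

Require Import Defs.
From mathcomp Require Import all_boot all_order all_algebra.
From mathcomp Require Import finmap.
From mathcomp Require Import boolp classical_sets cardinality reals.
From mathcomp Require Import filter functions fraction ring.
From mathcomp Require exp.

Set Implicit Arguments.
Unset Strict Implicit.
Unset Printing Implicit Defensive.

Import Order.TTheory GRing.Theory Num.Theory.
Local Open Scope ring_scope.
Local Open Scope classical_set_scope.

(** * Algebraic dependence and critical values *)

(** Faces of Newton polytopes never appear as geometric objects. Along an ultrafilter the ratio of
    each monomial to a dominating one has a limit, and the set [S] of monomials with nonzero limit
    plays the role of a face system. Genericity is imposed for every subset [S] of the finite index
    set, which costs only a finite product of polynomials. The hull condition enters through one
    fact: [log |x^a|] is linear in [a], so a monomial in the hull is never larger than all the
    monomials spanning it.

    The genericity conditions must be nonzero polynomials, whereas the natural statement is that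
    some image is not dense. Explicit algebraic relations make the passage: a counting argument
    produces one between too many polynomials, and differentiating minimal relations treats families
    with degenerate Jacobian.

    The endpoints of the deformation are special in the common coefficient space, since some of
    their coefficients may be 0, and the segment between them may a priori lie inside the bad
    hypersurface. The path is therefore bent through a generic point, and its time runs along a
    complex arc that avoids finitely many roots. *)

Definition alg_dependent (C : fieldType) (M P : nat)
    (t : P.-tuple {mpoly C[M]}) : Prop :=
  exists2 h : {mpoly C[P]}, h != 0 & h \mPo t = 0.

(** * Algebraic dependence by counting monomials *)

Section Counting.
Variables (C : fieldType) (M : nat).
Implicit Types p q : {mpoly C[M]}.

(** [msize] is the degree plus one, and 0 for the zero polynomial; the bound [a.+1] thus means
    degree at most [a] with no exception for zero. *)
Lemma msizeM_bound p q a b : (msize p <= a.+1)%N -> (msize q <= b.+1)%N ->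
  (msize (p * q) <= (a + b).+1)%N.
Proof.
move=> pa qb.
have [->|p0] := eqVneq p 0; first by rewrite mul0r msize0.
have [->|q0] := eqVneq q 0; first by rewrite mulr0 msize0.
rewrite msizeM //; move: pa qb; case: (msize p) (msize q) => [|x] [|y] //=.
- by move=> _; rewrite ltnS => /leq_trans; apply; rewrite (leq_trans (leq_addl a b)).
- by rewrite addn0 ltnS => /leq_trans xa _; apply: xa; rewrite (leq_trans (leq_addr b a)).
by rewrite !ltnS addnS ltnS => xa yb; rewrite leq_add.
Qed.

Lemma msizeX_bound p a k : (msize p <= a.+1)%N -> (msize (p ^+ k) <= (a * k).+1)%N.
Proof.
move=> pa; elim: k => [|k IH]; first by rewrite expr0 msize1.
by rewrite exprS mulnS msizeM_bound.
Qed.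

Lemma msize_prod_bound (I : finType) (F : I -> {mpoly C[M]}) (a : I -> nat) :
  (forall i, (msize (F i) <= (a i).+1)%N) ->
  (msize (\prod_i F i) <= (\sum_i a i).+1)%N.
Proof.
move=> H; elim/big_ind2: _ => //; first by rewrite msize1.
by move=> x1 n1 x2 n2 *; apply: msizeM_bound.
Qed.

(** Polynomials in [P] variables with exponents below [D] form a space of dimension [D ^ P], while
    their composites with [t] have exponents below [E] and live in dimension [E ^ M]. As [E] is
    linear in [D] and [M < P], a large [D] forces a nontrivial kernel. *)
Lemma alg_dependent_lt (P : nat) (t : P.-tuple {mpoly C[M]}) :
  (M < P)%N -> alg_dependent t.
Proof.
move=> MP.
pose d := (\max_(i < P) msize (tnth t i))%N.
have szt i : (msize (tnth t i) <= d.+1)%N.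
  by apply: leqW; rewrite /d; apply: (leq_bigmax (F := fun i => msize (tnth t i))).
(* Chosen larger than [(P * d + 2) ^ M]: then [E <= D * (P * d + 2)] gives
   [E ^ M < D * D ^ M <= D ^ P]. *)
pose D := ((P * d).+2 ^ M).+1.
pose E := (D * (P * d).+1).+1.
have card_lt : (E ^ M < D ^ P)%N.
  have ED : (E <= D * (P * d).+2)%N by rewrite /E [(D * _.+2)%N]mulnS addnC -addn1 leq_add2l.
  have : (E ^ M <= (D * (P * d).+2) ^ M)%N by case: (M) => [//|m]; rewrite leq_exp2r.
  move=> /leq_ltn_trans; apply.
  have -> : (D ^ P = D ^ (P - M) * D ^ M)%N by rewrite -expnD subnK // ltnW.
  rewrite expnMn mulnC ltn_pmul2r ?expn_gt0 //.
  have : (0 < P - M)%N by rewrite subn_gt0.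
  case: (P - M)%N => // m _; rewrite expnS; change (D <= D * D ^ m)%N.
  by rewrite -[X in (X <= _)%N]muln1 leq_mul2l expn_gt0 orbT.
pose row_t : finType := {ffun 'I_P -> 'I_D}.
pose col_t : finType := {ffun 'I_M -> 'I_E}.
pose mr (f : row_t) : 'X_{1..P} := [multinom (f i : nat) | i < P].
pose mc (f : col_t) : 'X_{1..M} := [multinom (f i : nat) | i < M].
pose q (f : row_t) : {mpoly C[M]} := 'X_[mr f] \mPo t.
pose A : 'M[C]_(#|row_t|, #|col_t|) :=
  \matrix_(a, b) (q (enum_val a))@_(mc (enum_val b)).
have kA : kermx A != 0.
  rewrite kermx_eq0 /row_free neq_ltn; apply/orP; left.
  apply: leq_ltn_trans (rank_leq_col _) _.
  by rewrite !card_ffun !card_ord.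
pose v := nz_row (kermx A).
have v0 : v != 0 by rewrite nz_row_eq0.
have vA : v *m A = 0 by apply/sub_kermxP; exact: nz_row_sub.
pose h : {mpoly C[P]} := \sum_a v 0 a *: 'X_[mr (enum_val a)].
have mr_inj : injective mr.
  move=> f g /mnmP fg; apply/ffunP => i; apply/val_inj.
  by have := fg i; rewrite !mnmE.
have hE a : h@_(mr (enum_val a)) = v 0 a.
  rewrite /h linear_sum (bigD1 a) //= big1 => [|b ba].
    by rewrite addr0 mcoeffZ mcoeffX eqxx mulr1.
  rewrite mcoeffZ mcoeffX; case: eqP => [/mr_inj/enum_val_inj ab|_]; last by rewrite mulr0.
  by rewrite ab eqxx in ba.
exists h.
  apply: contraNneq v0 => h0; apply/eqP/rowP => a.
  by rewrite -hE h0 mcoeff0 mxE.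
apply/mpolyP => m; rewrite mcoeff0 (_ : h \mPo t = \sum_a v 0 a *: q (enum_val a)); last first.
  by rewrite /h raddf_sum; apply: eq_bigr => a _; rewrite /= comp_mpolyZ.
rewrite raddf_sum /=.
(* Outside the box of exponents below [E] the coefficient vanishes by degree; inside it is an entry
   of [v *m A]. *)
have [mE|/existsNP[i /negP]] := pselect (forall i, (m i < E)%N); last first.
  rewrite -leqNgt => Em.
  apply: big1 => a _; rewrite mcoeffZ; apply/eqP.
  rewrite mulf_eq0; apply/orP; right; rewrite mcoeff_eq0.
  apply: msize_mdeg_ge.
  have mi : (m i <= mdeg m)%N by rewrite mdegE (bigD1 i) //= leq_addr.
  apply: leq_trans mi; apply: leq_trans Em.
  rewrite /q comp_mpolyX.
  apply: leq_trans (msize_prod_bound (a := fun i => d * (mr (enum_val a) i))%N _) _ => [j|].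
    exact: msizeX_bound.
  rewrite /E ltnS -big_distrr /=.
  apply: (@leq_trans (d * (P * D))).
    rewrite leq_mul2l; apply/orP; right.
    rewrite -[X in (_ <= X * _)%N]card_ord -sum_nat_const; apply: leq_sum => j _.
    by rewrite mnmE ltnW // ltn_ord.
  by rewrite mulnA mulnC [(d * P)%N]mulnC leq_mul2l leqnSn orbT.
pose f : col_t := [ffun i => Ordinal (mE i)].
have mf : m = mc f by apply/mnmP => i; rewrite !mnmE ffunE.
rewrite mf -[f]enum_rankK -[X in X = 0](_ : (v *m A) 0 (enum_rank f) = _).
  by rewrite vA mxE.
rewrite mxE; apply: eq_bigr => a _.
by rewrite mcoeffZ mxE.
Qed.
End Counting.

(** * The Jacobian criterion in characteristic zero *)

Section JacobianCriterion.
Variables (C : numFieldType).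

Lemma mderiv_var (M : nat) (i l : 'I_M) :
  ('X_i)^`M(l) = (i == l)%:R :> {mpoly C[M]}.
Proof.
rewrite mderivX mnmE; case: eqP => [->|_]; last by rewrite scale0r.
by rewrite scale1r -[(_ - _)%MM](_ : 0%MM = _) ?mpolyX0 //; apply/mnmP => j; rewrite !mnmE subnn.
Qed.

Lemma mderiv_comp (M P : nat) (t : P.-tuple {mpoly C[M]}) (g : {mpoly C[P]})
    (l : 'I_M) :
  (g \mPo t)^`M(l) = \sum_q (g^`M(q) \mPo t) * (tnth t q)^`M(l).
Proof.
pose chain (g : {mpoly C[P]}) :=
  (g \mPo t)^`M(l) = \sum_q (g^`M(q) \mPo t) * (tnth t q)^`M(l).
have chainC c : chain c%:MP.
  by rewrite /chain comp_mpolyC mderivC big1 // => q _; rewrite mderivC comp_mpoly0 mul0r.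
have chainM p q : chain p -> chain q -> chain (p * q).
  rewrite /chain => Hp Hq; rewrite rmorphM /= mderivM Hp Hq mulr_suml mulr_sumr -big_split /=.
  by apply: eq_bigr => i _; rewrite mderivM comp_mpolyD !rmorphM /=; ring.
have chainD p q : chain p -> chain q -> chain (p + q).
  rewrite /chain => Hp Hq; rewrite comp_mpolyD mderivD Hp Hq -big_split /=.
  by apply: eq_bigr => i _; rewrite mderivD comp_mpolyD mulrDl.
have chainX i : chain 'X_i.
  rewrite /chain comp_mpolyXU -tnth_nth (bigD1 i) //= big1 => [|q qi].
    by rewrite addr0 mderiv_var eqxx comp_mpoly1 mul1r.
  by rewrite mderiv_var (eq_sym i) (negbTE qi) comp_mpoly0 mul0r.
change (chain g); elim/mpolyind: g => [|c m p _ _ IH]; first by rewrite -mpolyC0.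
apply: chainD => //; rewrite -mul_mpolyC; apply: (chainM) => //.
rewrite mpolyXE_id; elim/big_ind: _ => //; first by rewrite -mpolyC1.
move=> i _; elim: (m i) => [|k IHk]; first by rewrite expr0 -mpolyC1.
by rewrite exprS; apply: chainM.
Qed.

Lemma msize_mderiv_lt (P : nat) (g : {mpoly C[P]}) (i : 'I_P) :
  g != 0 -> (msize g^`M(i) < msize g)%N.
Proof.
move=> g0; rewrite -(@prednK (msize g)) ?lt0n ?msize_poly_eq0 // ltnS.
rewrite mmeasureE; apply/bigmax_leqP_seq => m.
rewrite mcoeff_msupp mcoeff_mderiv => mg _.
have : (m + U_(i))%MM \in msupp g.
  by rewrite mcoeff_msupp; apply: contraNneq mg => ->; rewrite mul0rn.
by move=> /msize_mdeg_lt; rewrite mdegD mdeg1 addn1; case: (msize g).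
Qed.

Lemma lift_ord_max (P : nat) (j : 'I_P) : lift ord_max j = widen_ord (leqnSn P) j.
Proof. by apply/val_inj; rewrite /= /bump leqNgt ltn_ord. Qed.

Lemma mnmwiden_init (P : nat) (m : 'X_{1..P.+1}) : m ord_max = 0%N ->
  m = mnmwiden [multinom m (widen_ord (leqnSn P) i) | i < P].
Proof.
move=> m0; apply/mnmP => i; case: (unliftP ord_max i) => [j|] ->.
  by rewrite lift_ord_max mnmwiden_widen mnmE.
by rewrite mnmwiden_ordmax.
Qed.

(** Characteristic zero enters here: the factor [m ord_max] produced by differentiation kills no
    coefficient, so only monomials free of the last variable can occur. *)
Lemma mderiv_last_eq0 (P : nat) (g : {mpoly C[P.+1]}) :
  g^`M(ord_max) = 0 -> exists h, g = mwiden h.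
Proof.
move=> dg0.
have supp m : m \in msupp g -> m ord_max = 0%N.
  move=> mg; apply/eqP; apply: contraTT mg => m0.
  have U_le : (U_(ord_max) <= m)%MM by rewrite lep1mP.
  have := congr1 (mcoeff (m - U_(ord_max))) dg0.
  rewrite mcoeff_mderiv mcoeff0 submK // => /eqP.
  by rewrite mulrn_eq0 /= mcoeff_msupp negbK.
exists (\sum_(m <- msupp g) g@_m *: 'X_[[multinom m (widen_ord (leqnSn P) i) | i < P]]).
rewrite raddf_sum /= [LHS]mpolyE big_seq [RHS]big_seq; apply: eq_bigr => m mg.
by rewrite mwidenZ mwidenX -mnmwiden_init ?supp.
Qed.

Lemma tnth_rcons_last (T : Type) (P : nat) (t : P.-tuple T) x :
  tnth [tuple of rcons t x] ord_max = x.
Proof. by rewrite (tnth_nth x) /= nth_rcons size_tuple ltnn eqxx. Qed.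

Lemma tnth_rcons_widen (T : Type) (P : nat) (t : P.-tuple T) x i :
  tnth [tuple of rcons t x] (widen_ord (leqnSn P) i) = tnth t i.
Proof. by rewrite !(tnth_nth x) /= nth_rcons size_tuple ltn_ord. Qed.

Lemma comp_mwiden (M P : nat) (t : P.-tuple {mpoly C[M]}) x (h : {mpoly C[P]}) :
  mwiden h \mPo [tuple of rcons t x] = h \mPo t.
Proof.
elim/mpolyind: h => [|c m h _ _ IH]; first by rewrite mwiden0 !comp_mpoly0.
rewrite mwidenD !comp_mpolyD IH; congr (_ + _).
rewrite mwidenZ !comp_mpolyZ mwidenX !comp_mpolyX big_ord_recr /=.
rewrite mnmwiden_ordmax expr0 mulr1; congr (_ *: _); apply: eq_bigr => i _.
by rewrite tnth_rcons_widen mnmwiden_widen.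
Qed.

(** If the last partial derivative of a relation is again a relation, either it is nonzero and
    smaller, and the descent continues, or it is 0 and the relation involves [t] alone, against the
    independence of [t]. *)
Lemma minimal_relation (M P : nat) (t : P.-tuple {mpoly C[M]}) x :
  ~ alg_dependent t -> alg_dependent [tuple of rcons t x] ->
  exists2 g : {mpoly C[P.+1]}, g \mPo [tuple of rcons t x] = 0
    & g^`M(ord_max) \mPo [tuple of rcons t x] != 0.
Proof.
set t' := [tuple of rcons t x] => indep_t [h].
elim: (msize h) {-2}h (leqnn (msize h)) => {h} [|s IH] h.
  by rewrite leqn0 msize_poly_eq0 => ->.
move=> hs h0 ht.
have [|] := eqVneq (h^`M(ord_max) \mPo t') 0; last by exists h.
have [/mderiv_last_eq0[h1 hE]|dh0] := eqVneq h^`M(ord_max) 0.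
  case: indep_t; exists h1; first by apply: contraNneq h0 => h10; rewrite hE h10 mwiden0.
  by rewrite -(comp_mwiden t x) -hE.
by apply: IH => //; rewrite -ltnS (leq_trans _ hs) // msize_mderiv_lt.
Qed.

(** Over the fraction field the nonsingular product forces [D] to have rank at least [M >= P], so
    its rows are independent. *)
Lemma left_kernel0 (A : idomainType) (M P : nat) (B : 'M[A]_(M, P))
    (D : 'M[A]_(P, M)) (e : 'I_M -> A) : (P <= M)%N ->
  B *m D = diag_mx (\row_i e i) -> (forall i, e i != 0) ->
  forall v : 'rV[A]_P, v *m D = 0 -> v = 0.
Proof.
move=> PM BD e0 v vD; pose f : {rmorphism A -> {fraction A}} := @tofrac A.
have Eu : diag_mx (\row_i f (e i)) \in unitmx.
  rewrite unitmxE det_diag unitfE prodf_seq_neq0; apply/allP => i _ /=.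
  by rewrite mxE tofrac_eq0.
have fE : map_mx f B *m map_mx f D = diag_mx (\row_i f (e i)).
  rewrite -map_mxM BD map_diag_mx; congr diag_mx.
  by apply/rowP => i; rewrite !mxE.
have rD : row_free (map_mx f D).
  rewrite /row_free eqn_leq rank_leq_row /=.
  apply: leq_trans PM _; move: Eu; rewrite -row_full_unit -fE => /eqP {1}<-.
  exact: mxrankM_maxr.
have /eqP : map_mx f v *m map_mx f D = 0 by rewrite -map_mxM vD map_mx0.
rewrite mulmx_free_eq0 // => /eqP/rowP vf; apply/rowP => p.
by have /eqP := vf p; rewrite !mxE tofrac_eq0 => /eqP.
Qed.

(* Adjoining coordinates to an independent family [t] as long as it stays
   independent makes every coordinate separably algebraic over [t]; deriving
   the minimal relations then inverts the Jacobian matrix of [t]. *)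
Theorem jacobian_criterion (M P : nat) (t : P.-tuple {mpoly C[M]})
    (v : 'I_P -> {mpoly C[M]}) (p0 : 'I_P) :
  v p0 != 0 -> (forall l, \sum_p v p * (tnth t p)^`M(l) = 0) -> alg_dependent t.
Proof.
move=> vp0 rel; apply: contrapT => indep_t.
(* Induction on [M - P], which drops with each adjoined coordinate. *)
have [k] := ubnP (M - P); elim: k => // k IH in P t v p0 vp0 rel indep_t *.
move=> MPk.
have PM : (P <= M)%N.
  by rewrite leqNgt; apply/negP => /(alg_dependent_lt t).
have [[i indep_ti]|dep_t] :=
    pselect (exists i : 'I_M, ~ alg_dependent [tuple of rcons t 'X_i]).
  have MP : (P < M)%N.
    by rewrite ltnNge; apply/negP => MP; apply: indep_ti; apply: alg_dependent_lt.
  (* Padding the covector with 0 in the new slot preserves the relation between the gradients. *)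
  pose v' (q : 'I_P.+1) := if unlift ord_max q is Some p then v p else 0.
  have v'w p : v' (widen_ord (leqnSn P) p) = v p by rewrite /v' -lift_ord_max liftK.
  apply: (IH _ [tuple of rcons t 'X_i] v' (widen_ord (leqnSn P) p0)) => //.
  - by rewrite v'w.
  - move=> l; rewrite big_ord_recr /= [v' _](_ : _ = 0); last by rewrite /v' unlift_none.
    rewrite mul0r addr0 -[RHS](rel l); apply: eq_bigr => p _.
    by rewrite v'w tnth_rcons_widen.
  by rewrite -ltnS (leq_trans _ MPk) // ltnS ltn_sub2l.
have /choice[g gP] (i : 'I_M) : exists g : {mpoly C[P.+1]},
    g \mPo [tuple of rcons t 'X_i] = 0 /\ g^`M(ord_max) \mPo [tuple of rcons t 'X_i] != 0.
  have [|g gt dg] := @minimal_relation M P t 'X_i indep_t; last by exists g.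
  by apply: contrapT => H; apply: dep_t; exists i.
pose e i := (g i)^`M(ord_max) \mPo [tuple of rcons t 'X_i].
pose B : 'M_(M, P) := \matrix_(i, p)
  ((g i)^`M(widen_ord (leqnSn P) p) \mPo [tuple of rcons t 'X_i]).
pose D : 'M_(P, M) := \matrix_(p, l) (tnth t p)^`M(l).
(* Derivative in the variable [l] of the relation [g i] at [(t, X_i)]: the last slot contributes
   [e i] exactly when [l = i]. *)
have BD : B *m D = diag_mx (\row_i (- e i)).
  apply/matrixP => i l; rewrite !mxE.
  have := congr1 (mderiv l) (gP i).1; rewrite mderiv_comp mderiv0 big_ord_recr /=.
  rewrite tnth_rcons_last mderiv_var => /eqP; rewrite addr_eq0 => /eqP H.
  transitivity (- (e i * (i == l)%:R)); last first.
    by case: eqP => _; rewrite ?mulr1 ?mulr0 ?oppr0.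
  by rewrite -H; apply: eq_bigr => p _; rewrite !mxE tnth_rcons_widen.
suff /rowP/(_ p0) : \row_p v p = 0 by rewrite !mxE => /eqP; rewrite (negbTE vp0).
apply: (left_kernel0 PM BD) => [i|]; first by rewrite oppr_eq0 (gP i).2.
by apply/rowP => l; rewrite !mxE -[RHS](rel l); apply: eq_bigr => p _; rewrite !mxE.
Qed.

End JacobianCriterion.

(** * Critical values lie in a hypersurface *)

Section CriticalValues.
Variables (C : numFieldType).

Definition set_last0 (P : nat) (g : {mpoly C[P.+1]}) : {mpoly C[P]} :=
  g \mPo [tuple of rcons [tuple 'X_i | i < P] 0].

Lemma mcoeff_set_last0 (P : nat) (g : {mpoly C[P.+1]}) r :
  (set_last0 g)@_r = g@_(mnmwiden r).
Proof.
rewrite /set_last0; elim/mpolyind: g => [|c m g _ _ IH].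
  by rewrite comp_mpoly0 !mcoeff0.
rewrite comp_mpolyD !mcoeffD IH comp_mpolyZ !mcoeffZ mcoeffX; congr (c * _ + _).
rewrite comp_mpolyX big_ord_recr /= tnth_rcons_last.
rewrite (eq_bigr (fun i => 'X_i ^+ (m (widen_ord (leqnSn P) i)))); last first.
  by move=> i _; rewrite tnth_rcons_widen tnth_mktuple.
have [m0|m0] := eqVneq (m ord_max) 0%N; last first.
  rewrite expr0n (negbTE m0) mulr0 mcoeff0; case: eqP => // mE.
  by rewrite mE mnmwiden_ordmax eqxx in m0.
rewrite m0 expr0 mulr1.
pose m' := [multinom m (widen_ord (leqnSn P) i) | i < P].
have -> : \prod_(i < P) 'X_i ^+ m (widen_ord (leqnSn P) i) = 'X_[m'] :> {mpoly C[P]}.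
  by rewrite mpolyXE_id; apply: eq_bigr => i _; rewrite mnmE.
rewrite (mnmwiden_init m0) -/m'.
by rewrite mcoeffX (inj_eq (@inj_mnmwiden _)).
Qed.

Lemma factor_last (P : nat) (g : {mpoly C[P.+1]}) : set_last0 g = 0 ->
  exists g1, g = g1 * 'X_ord_max.
Proof.
move=> g0; exists (\sum_(m <- msupp g) g@_m *: 'X_[m - U_(ord_max)]).
rewrite mulr_suml [LHS]mpolyE big_seq [RHS]big_seq; apply: eq_bigr => m mg.
rewrite -scalerAl -mpolyXD submK // lep1mP; apply: contraTneq mg => m0.
by rewrite mcoeff_msupp (mnmwiden_init m0) -mcoeff_set_last0 g0 mcoeff0 eqxx.
Qed.

(** Since [x != 0] in a domain, a relation divisible by the last variable may be divided by it; the
    size drops, so this stops. *)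
Lemma relation_nonzero_at0 (M P : nat) (t : P.-tuple {mpoly C[M]}) x : x != 0 ->
  alg_dependent [tuple of rcons t x] ->
  exists2 g, set_last0 g != 0 & g \mPo [tuple of rcons t x] = 0.
Proof.
set t' := [tuple of rcons t x] => x0 [h].
elim: (msize h) {-2}h (leqnn (msize h)) => {h} [|s IH] h.
  by rewrite leqn0 msize_poly_eq0 => ->.
move=> hs h0 ht; have [/factor_last[g hE]|] := eqVneq (set_last0 h) 0; last by exists h.
have g0 : g != 0 by apply: contraNneq h0 => g0; rewrite hE g0 mul0r.
apply: (IH g) => //; last first.
  move/eqP: ht; rewrite hE rmorphM /= comp_mpolyXU -tnth_nth tnth_rcons_last.
  by rewrite mulf_eq0 (negbTE x0) orbF => /eqP.
move: hs; rewrite hE msizeM //; last by rewrite -msize_poly_eq0 msizeX.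
rewrite msizeX mdeg1 addn2 /= ltnS.
by move=> /leq_trans; apply.
Qed.

(* Either the Jacobian determinant vanishes identically and the components are
   dependent, or an algebraic relation between the components and the Jacobian
   determinant, not divisible by the latter, bounds the critical values. *)
Theorem critical_values_in_hypersurface (P : nat) (t : P.-tuple {mpoly C[P]}) :
  exists2 h : {mpoly C[P]}, h != 0 &
  forall z : 'I_P -> C, h.@[fun q => (tnth t q).@[z]] != 0 ->
  forall tau : 'I_P -> C,
    (forall q, \sum_l ((tnth t q)^`M(l)).@[z] * tau l = 0) -> forall l, tau l = 0.
Proof.
pose J : 'M_P := \matrix_(q, l) (tnth t q)^`M(l).
have [/eqP/det0P[v v0 vJ]|J0] := eqVneq (\det J) 0.
  have /rV0Pn[p vp0] := v0.
  have [|h h0 ht] := @jacobian_criterion C P P t (fun p => v 0 p) p vp0.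
    move=> l; have /rowP/(_ l) := vJ; rewrite !mxE => vl; rewrite -[RHS]vl.
    by apply: eq_bigr => q _; rewrite mxE.
  exists h => // z; have := congr1 (meval z) ht.
  by rewrite comp_mpoly_meval meval0 => ->; rewrite eqxx.
have [g g0 gt] := relation_nonzero_at0 J0 (@alg_dependent_lt C P P.+1 [tuple of rcons t (\det J)] (ltnSn P)).
exists (set_last0 g) => // z hz tau tauJ.
have Jz : (\det J).@[z] != 0.
  apply: contraNneq hz => Jz; apply/eqP.
  have := congr1 (meval z) gt; rewrite meval0 => <-.
  rewrite /set_last0 !comp_mpoly_meval; apply: meval_eq => i.
  case: (unliftP ord_max i) => [j|] ->; last by rewrite !tnth_rcons_last meval0 Jz.
  by rewrite lift_ord_max !tnth_rcons_widen tnth_mktuple mevalXU.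
move: Jz; rewrite -det_map_mx -unitfE -unitmxE -unitmx_tr -row_free_unit => Jfree.
pose T : 'rV[C]_P := \row_l tau l.
suff /rowP T0 : T = 0 by move=> l; have := T0 l; rewrite !mxE.
apply/eqP; rewrite -(mulmx_free_eq0 T Jfree); apply/eqP/rowP => q.
rewrite !mxE -[RHS](tauJ q); apply: eq_bigr => l _.
by rewrite !mxE mulrC.
Qed.

End CriticalValues.

(** * Families swept out by a torus *)

Section TorusFamilies.
Variables (C : numFieldType).

Lemma mul_mderivX (M : nat) (i : 'I_M) m :
  'X_i * ('X_[m])^`M(i) = (m i)%:R *: 'X_[m] :> {mpoly C[M]}.
Proof.
rewrite mderivX -scalerAr -mpolyXD; have [->|mi] := eqVneq (m i) 0%N.
  by rewrite !scale0r.
by rewrite addmC submK // lep1mP.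
Qed.

(* For [d] constrained as below, the family [d a * z ^ b a] sweeps out a
   hypersurface: its tangent spaces are annihilated by the covector
   [(z ^ - b a)_a], because [\sum_a d a = 0] (the dual variety of a torus orbit). *)
Lemma torus_family_in_hypersurface (I J : finType) (S : {set I}) (b : I -> J -> nat)
    (s0 : I) : s0 \in S ->
  exists2 h : {mpoly C[#|I|]}, h != 0 &
  forall (c d : I -> C) (z : J -> C),
    (forall a, a \in S -> c a = d a * \prod_i z i ^+ b a i) ->
    \sum_(a in S) d a = 0 ->
    (forall i, \sum_(a in S) d a * (b a i)%:R = 0) ->
    h.@[fun l => c (enum_val l)] = 0.
Proof.
move=> s0S.
(* Column [None] encodes the condition on the sum of the [d a] and column [Some i] the one weighted
   by [b a i]; restricted to [S], the rows of the kernel [K] span the admissible [d]. *)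
pose A : 'M[C]_(#|I|, #|{: option J}|) := \matrix_(a, i)
  if enum_val a \in S then (if enum_val i is Some i then (b (enum_val a) i)%:R else 1) else 0.
pose K := kermx A.
have KS l : \sum_(a in S) K l (enum_rank a) = 0.
  have /matrixP/(_ l (enum_rank None)) := mulmx_ker A.
  rewrite !mxE => H0; rewrite -[RHS]H0 (reindex (@enum_val I I)) /=; last exact: onW_bij (@enum_val_bij _).
  rewrite big_mkcond; apply: eq_bigr => a _; rewrite !mxE !enum_valK enum_rankK.
  by case: ifP => _; rewrite ?mulr1 ?mulr0.
have Kb l i : \sum_(a in S) K l (enum_rank a) * (b a i)%:R = 0.
  have /matrixP/(_ l (enum_rank (Some i))) := mulmx_ker A.
  rewrite !mxE => H0; rewrite -[RHS]H0 (reindex (@enum_val I I)) /=; last exact: onW_bij (@enum_val_bij _).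
  rewrite big_mkcond; apply: eq_bigr => a _; rewrite !mxE !enum_valK enum_rankK.
  by case: ifP => _; rewrite ?mulr0.
(* The three kinds of parameters: coefficients on the rows of [K], free coordinates for the indices
   outside [S], and torus coordinates. *)
pose V : finType := (('I_#|I| + I) + J)%type.
pose X (v : V) : {mpoly C[#|V|]} := 'X_(enum_rank v).
have dX v w : (X v)^`M(enum_rank w) = (v == w)%:R.
  by rewrite mderiv_var (inj_eq enum_rank_inj).
pose mm (a : I) : 'X_{1..#|V|} := [multinom (if enum_val v is inr i then b a i else 0%N) | v < #|V|].
pose mono a : {mpoly C[#|V|]} := 'X_[mm a].
have dmono0 a v : (if v is inr _ then false else true) -> (mono a)^`M(enum_rank v) = 0.
  by rewrite mderivX mnmE enum_rankK; case: v => // v _; rewrite scale0r.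
have dmono a i : X (inr i) * (mono a)^`M(enum_rank (inr i : V)) = (b a i)%:R *: mono a.
  by rewrite mul_mderivX mnmE enum_rankK.
pose dp a : {mpoly C[#|V|]} := \sum_l K l (enum_rank a) *: X (inl (inl l)).
pose Phi a := if a \in S then dp a * mono a else X (inl (inr a)).
(* The annihilating covector [z ^ - b a], cleared of denominators by the product [MM] of all
   monomials. *)
pose v a := if a \in S then \prod_(a' in S | a' != a) mono a' else 0.
pose MM := \prod_(a in S) mono a.
have vmono a : a \in S -> v a * mono a = MM.
  by move=> aS; rewrite /MM (bigD1 a) //= /v aS mulrC.
have rel w : \sum_(a in S) v a * (dp a * mono a)^`M(enum_rank w) = 0.
  have dE a l : (dp a)^`M(enum_rank l) = \sum_k (K k (enum_rank a) * (inl (inl k) == l)%:R)%:MP.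
    rewrite raddf_sum; apply: eq_bigr => k _ /=.
    by rewrite mderivZ dX mpolyCM mul_mpolyC -mpolyC_nat.
  case: w => [[l|a0]|i].
  - transitivity (\sum_(a in S) K l (enum_rank a) *: MM); last first.
      by rewrite -scaler_suml KS scale0r.
    apply: eq_bigr => a aS; rewrite mderivM dmono0 // mulr0 addr0 dE.
    rewrite (bigD1 l) //= eqxx mulr1 big1 => [|k kl].
      by rewrite addr0 mulrCA vmono // mul_mpolyC.
    by rewrite (inj_eq (@inl_inj _ _)) (inj_eq (@inl_inj _ _)) (negbTE kl) mulr0 mpolyC0.
  - apply: big1 => a aS; rewrite mderivM dmono0 // mulr0 addr0 dE big1 ?mul0r ?mulr0 //.
    by move=> k _; rewrite mulr0 mpolyC0.
  (* Multiplication by the variable, which is cancellable, makes the derivative act on each monomial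
     as the scalar [b a i]. *)
  - have Xi0 : X (inr i) != 0 by rewrite -msize_poly_eq0 msizeX.
    apply: (mulfI Xi0); rewrite mulr0 mulr_sumr.
    transitivity (\sum_(a in S) dp a * ((b a i)%:R *: MM)).
      apply: eq_bigr => a aS; rewrite mderivM dE big1 => [|k _]; last first.
        by rewrite mulr0 mpolyC0.
      by rewrite mul0r add0r mulrCA [X _ * _]mulrCA dmono mulrCA -!scalerAr vmono.
    transitivity (\sum_l (\sum_(a in S) K l (enum_rank a) * (b a i)%:R) *: (X (inl (inl l)) * MM)).
      rewrite (eq_bigr (fun a => \sum_l (K l (enum_rank a) * (b a i)%:R) *: (X (inl (inl l)) * MM))).
        by rewrite exchange_big /=; apply: eq_bigr => l _; rewrite scaler_suml.
      move=> a aS; rewrite /dp mulr_suml; apply: eq_bigr => l _.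
      by rewrite -scalerAr -!scalerAl scalerA mulrC.
    by apply: big1 => l _; rewrite Kb scale0r.
have [||h h0 ht] := @jacobian_criterion C #|V| #|I| [tuple Phi (enum_val q) | q < #|I|]
    (fun q => v (enum_val q)) (enum_rank s0).
- rewrite enum_rankK /v s0S; apply/prodf_neq0 => a _.
  by rewrite -msize_poly_eq0 msizeX.
- move=> w; rewrite -[w]enum_valK -[RHS](rel (enum_val w)).
  rewrite [RHS]big_mkcond [RHS](reindex (@enum_val I I)) /=; last exact: onW_bij (@enum_val_bij _).
  apply: eq_bigr => q _; rewrite tnth_mktuple /v /Phi.
  by case: ifP => // _; rewrite mul0r.
exists h => // c d z cS dS dbS.
pose d' := \row_(a < #|I|) (if enum_val a \in S then d (enum_val a) else 0).
have /submxP[t tE] : (d' <= K)%MS.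
  apply/sub_kermxP/rowP => i; rewrite !mxE.
  rewrite (reindex (@enum_rank _)) /=; last exact: onW_bij (@enum_rank_bij _).
  rewrite (eq_bigr (fun a => if a \in S then d a * (if enum_val i is Some i then (b a i)%:R else 1) else 0)).
    rewrite -big_mkcond /=; case: (enum_val i) => [k|]; first exact: dbS.
    by rewrite -[RHS]dS; apply: eq_bigr => a _; rewrite mulr1.
  by move=> a _; rewrite !mxE enum_rankK; case: ifP => _; rewrite ?mulr0.
pose w (q : 'I_#|V|) := match enum_val q with
  | inl (inl l) => t 0 l | inl (inr a) => c a | inr i => z i end.
have := congr1 (meval w) ht; rewrite meval0 comp_mpoly_meval => <-.
apply: meval_eq => q; rewrite tnth_mktuple /Phi; case: ifP => [qS|_]; last first.
  by rewrite mevalXU /w enum_rankK.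
rewrite cS // mevalM mevalX; congr (_ * _).
  have /rowP/(_ q) := tE; rewrite !mxE qS => ->; rewrite raddf_sum /=.
  by apply: eq_bigr => l _; rewrite mevalZ mevalXU /w enum_rankK enum_valK mulrC.
rewrite (reindex (@enum_rank _)) /=; last exact: onW_bij (@enum_rank_bij _).
rewrite [RHS]big_sumType /= [X in _ = X * _]big1 ?mul1r.
  by apply: eq_bigr => i _; rewrite mnmE /w enum_rankK.
by move=> i _; rewrite mnmE enum_rankK expr0.
Qed.
End TorusFamilies.

(** * The ML system and nondegeneracy of its solutions *)

Section MLSystem.
Variables (C : numFieldType) (T : finType) (n k : nat).
Variables (jj : T -> 'I_k) (b : T -> 'I_n -> nat).

Definition monom (x : 'I_n -> C) (a : T) : C := \prod_i x i ^+ b a i.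

(* The ML equations with terms grouped by monomial: [c a] is the coefficient of
   the monomial of exponent [b a] in the polynomial of index [jj a], and
   [x_i d(x^b)/dx_i = b_i x^b]. *)
Definition ml_solution (c : T -> C) (u : 'I_n -> C) (x : 'I_n -> C) (lam : 'I_k -> C) :=
  (forall i, u i = \sum_a lam (jj a) * (c a * monom x a) * (b a i)%:R) /\
  (forall j, \sum_(a | jj a == j) c a * monom x a = 0).

(* Kernel of the Jacobian matrix in the logarithmic coordinates [xi_i = dx_i / x_i]. *)
Definition ml_kernel (c : T -> C) (x : 'I_n -> C) (lam : 'I_k -> C)
    (xi : 'I_n -> C) (mu : 'I_k -> C) :=
  (forall j, \sum_(a | jj a == j) c a * monom x a * (\sum_i (b a i)%:R * xi i) = 0) /\
  (forall i, \sum_a (mu (jj a) + lam (jj a) * (\sum_l (b a l)%:R * xi l))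
                      * (c a * monom x a) * (b a i)%:R = 0).

Lemma monom_inv (x : 'I_n -> C) a : monom (fun i => (x i)^-1) a = (monom x a)^-1.
Proof. by rewrite /monom -prodfV; apply: eq_bigr => i _; rewrite exprVn. Qed.

Lemma monom_neq0 (x : 'I_n -> C) a : (forall i, x i != 0) -> monom x a != 0.
Proof. by move=> x0; apply/prodf_neq0 => i _; rewrite expf_neq0. Qed.

(* The solutions of all ML systems are parametrized by [y = 1/x], the terms
   [d a = c a * x ^ b a] and [lam]: one of the terms of each polynomial is
   determined by the others, and its slot is used for the multiplier. *)
Lemma generic_nondegenerate (pick : 'I_k -> T) : (forall j, jj (pick j) = j) ->
  exists2 h : {mpoly C[#|{: T + 'I_n}|]}, h != 0 &
  forall p : T + 'I_n -> C, h.@[fun l => p (enum_val l)] != 0 ->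
  forall x lam, (forall i, x i != 0) ->
    ml_solution (fun a => p (inl a)) (fun i => p (inr i)) x lam ->
  forall xi mu, ml_kernel (fun a => p (inl a)) x lam xi mu ->
    (forall i, xi i = 0) /\ (forall j, mu j = 0).
Proof.
move=> pickK; pose V : finType := (T + 'I_n)%type.
pose X (v : V) : {mpoly C[#|V|]} := 'X_(enum_rank v).
pose dp a : {mpoly C[#|V|]} := if a == pick (jj a)
  then - \sum_(a' | (jj a' == jj a) && (a' != a)) X (inl a') else X (inl a).
pose mm (a : T) : 'X_{1..#|V|} :=
  [multinom (if enum_val v is inr i then b a i else 0%N) | v < #|V|].
pose Phi (v : V) : {mpoly C[#|V|]} := match v with
  | inl a => dp a * 'X_[mm a]
  | inr i => \sum_a X (inl (pick (jj a))) * dp a * ((b a i)%:R)%:MP end.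
have [h h0 hP] := @critical_values_in_hypersurface C #|V| [tuple Phi (enum_val q) | q < #|V|].
exists h => // p hp x lam x0 [solu solf] xi mu [kerf keru].
pose d a := p (inl a) * monom x a.
pose bxi a := \sum_i (b a i)%:R * xi i.
pose z (v : V) := match v with
  | inl a => if a == pick (jj a) then lam (jj a) else d a
  | inr i => (x i)^-1 end.
(* The kernel vector [(xi, mu)] read in the parameters: with [c] fixed, [d a = c a * x ^ b a] varies
   by [d a * bxi a] and [1 / x i] by [- xi i / x i]. The kernel equations make the derivative [D]
   along it annihilate every component of [Phi]. *)
pose tau (v : V) := match v with
  | inl a => if a == pick (jj a) then mu (jj a) else d a * bxi a
  | inr i => - (xi i / x i) end.
pose ev (g : {mpoly C[#|V|]}) := g.@[fun l => z (enum_val l)].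
pose D (g : {mpoly C[#|V|]}) := \sum_l ev g^`M(l) * tau (enum_val l).
have evX v : ev (X v) = z v by rewrite /ev mevalXU enum_rankK.
have evsum (K : finType) (P : pred K) F : ev (\sum_(a | P a) F a) = \sum_(a | P a) ev (F a).
  exact: raddf_sum.
have evD f g : ev (f + g) = ev f + ev g by exact: mevalD.
have evM f g : ev (f * g) = ev f * ev g by exact: mevalM.
have evN f : ev (- f) = - ev f by exact: mevalN.
have evC c : ev c%:MP = c by exact: mevalC.
have DM f g : D (f * g) = D f * ev g + ev f * D g.
  rewrite /D mulr_suml mulr_sumr -big_split; apply: eq_bigr => l _ /=.
  by rewrite mderivM evD !evM; ring.
have DX v : D (X v) = tau v.
  rewrite /D (bigD1 (enum_rank v)) //= mderiv_var eqxx /ev meval1 mul1r enum_rankK.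
  rewrite big1 ?addr0 // => l lv.
  by rewrite mderiv_var eq_sym (negbTE lv) meval0 mul0r.
have DC c : D c%:MP = 0.
  by rewrite /D big1 // => l _; rewrite mderivC /ev meval0 mul0r.
have Dsum (K : finType) (P : pred K) F : D (\sum_(a | P a) F a) = \sum_(a | P a) D (F a).
  rewrite /D exchange_big; apply: eq_bigr => l _ /=.
  rewrite -mulr_suml; congr (_ * _).
  have -> : (\sum_(a | P a) F a)^`M(l) = \sum_(a | P a) (F a)^`M(l) by exact: raddf_sum.
  exact: evsum.
have DN f : D (- f) = - D f.
  by rewrite /D -sumrN; apply: eq_bigr => l _; rewrite mderivN evN mulNr.
have dpick a : a == pick (jj a) ->
    \sum_(a' | (jj a' == jj a) && (a' != a)) d a' = - d a.
  move=> _; have := solf (jj a); rewrite (bigD1 a) //= => /eqP.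
  by rewrite addrC addr_eq0 => /eqP.
have npick a a' : a == pick (jj a) -> jj a' = jj a -> a' != a -> (a' == pick (jj a')) = false.
  by move=> /eqP aE jE a'a; rewrite jE -aE (negbTE a'a).
have evdp a : ev (dp a) = d a.
  rewrite /dp; case: ifP => [aE|aE]; last by rewrite evX /= aE.
  rewrite -[RHS]opprK -dpick // evN evsum; congr (- _).
  apply: eq_bigr => a' /andP[/eqP jE a'a]; rewrite evX /=.
  by rewrite (npick a).
have Ddp a : D (dp a) = d a * bxi a.
  rewrite /dp; case: ifP => [aE|aE]; last by rewrite DX /= aE.
  have := kerf (jj a); rewrite (bigD1 a) //= => /eqP; rewrite addr_eq0 => /eqP.
  rewrite -/(d a) -/(bxi a) => ->; rewrite DN Dsum; congr (- _).
  apply: eq_bigr => a' /andP[/eqP jE a'a]; rewrite DX /=.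
  by rewrite (npick a).
have evmm a : ev 'X_[mm a] = (monom x a)^-1.
  rewrite /ev mevalX (reindex (@enum_rank _)) /=; last exact: onW_bij (@enum_rank_bij _).
  rewrite [LHS]big_sumType /= [X in X * _]big1 => [|a' _]; last by rewrite mnmE enum_rankK expr0.
  by rewrite mul1r -monom_inv; apply: eq_bigr => i _; rewrite mnmE enum_rankK.
have Dmm a : D 'X_[mm a] = - ((monom x a)^-1 * bxi a).
  rewrite /D (reindex (@enum_rank _)) /=; last exact: onW_bij (@enum_rank_bij _).
  rewrite [LHS]big_sumType /= [X in X + _]big1 => [|a' _]; last first.
    by rewrite mderivX mnmE enum_rankK scale0r /ev meval0 mul0r.
  rewrite add0r /bxi mulr_sumr -sumrN; apply: eq_bigr => i _.
  rewrite enum_rankK /= -evmm mulrN; congr (- _).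
  transitivity (ev ('X_(enum_rank (inr i : V)) * ('X_[mm a])^`M(enum_rank (inr i : V))) * xi i).
    by rewrite evM evX /=; ring.
  by rewrite mul_mderivX mnmE enum_rankK /ev mevalZ; ring.
have tau0 : forall l : 'I_#|V|, tau (enum_val l) = 0.
  apply: (hP (fun l => z (enum_val l))) => [|q].
    apply: contra_neq hp => <-; apply: meval_eq => q.
    rewrite tnth_mktuple -/(ev _); case: (enum_val q) => [a|i] /=.
      by rewrite evM evdp evmm /d mulfK // monom_neq0.
    rewrite solu evsum; apply: eq_bigr => a _.
    by rewrite !evM evC evdp evX /= pickK eqxx.
  rewrite tnth_mktuple -/(D _); case: (enum_val q) => [a|i] /=.
    by rewrite DM Ddp Dmm evdp evmm; ring.
  rewrite Dsum -[RHS](keru i); apply: eq_bigr => a _.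
  by rewrite !DM DC DX Ddp evM evC evdp evX /= pickK eqxx; rewrite /d /bxi; ring.
have {}tau0 v : tau v = 0 by rewrite -[v]enum_rankK tau0.
split=> [i|j].
  have /eqP := tau0 (inr i); rewrite /= oppr_eq0 mulf_eq0 invr_eq0 (negbTE (x0 i)) orbF.
  by move/eqP.
by have := tau0 (inl (pick j)); rewrite /= pickK eqxx.
Qed.

End MLSystem.

(** * Limits along an ultrafilter *)

Section UltraLimits.
Variables (K : numFieldType) (F : set_system nat).
Context {FU : UltraFilter F}.
Implicit Types (z w : nat -> K) (l : K).

Let FP : ProperFilter F := ultra_proper.
Local Existing Instance FP.

(** Stated over any [numFieldType], so that one calculus serves sequences in [R] and in [R[i]]. *)
Definition ulim z l := forall e : K, 0 < e -> \forall m \near F, `|z m - l| < e.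
Definition ubounded z := exists B : K, \forall m \near F, `|z m| <= B.

Lemma ultraP (P : set nat) : ~ (\forall m \near F, P m) -> \forall m \near F, ~ P m.
Proof. by case: (in_ultra_setVsetC P FU). Qed.

Lemma ulim_cst l : ulim (fun=> l) l.
Proof. by move=> e e0; apply: nearW => m; rewrite subrr normr0. Qed.

Lemma ulim_near z w l : ulim z l -> (\forall m \near F, z m = w m) -> ulim w l.
Proof.
move=> zl zw e e0; near=> m.
have -> : w m = z m by apply/esym; near: m.
by near: m; exact: (zl e e0).
Unshelve. all: by end_near. Qed.

Lemma ulim_ext z w l : (forall m, z m = w m) -> ulim z l -> ulim w l.
Proof. by move=> zw zl; apply: ulim_near zl _; apply: nearW. Qed.

Lemma ulimD z w l l' : ulim z l -> ulim w l' -> ulim (fun m => z m + w m) (l + l').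
Proof.
move=> zl wl e e0; have e2 : 0 < e / 2 by rewrite divr_gt0.
near=> m; rewrite opprD addrACA (splitr e).
apply: le_lt_trans (ler_normD _ _) _; apply: ltrD; near: m; [exact: zl|exact: wl].
Unshelve. all: by end_near. Qed.

Lemma ulimN z l : ulim z l -> ulim (fun m => - z m) (- l).
Proof.
move=> zl e e0; near=> m; rewrite -opprD normrN.
by near: m; exact: zl.
Unshelve. all: by end_near. Qed.

Lemma ulimB z w l l' : ulim z l -> ulim w l' -> ulim (fun m => z m - w m) (l - l').
Proof. by move=> zl wl; apply: ulimD => //; apply: ulimN. Qed.

Lemma ulim_bounded z l : ulim z l -> ubounded z.
Proof.
move=> zl; exists (1 + `|l|); near=> m.
rewrite -{1}(subrK l (z m)); apply: le_trans (ler_normD _ _) _.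
rewrite lerD2r; apply: ltW; near: m; exact: zl.
Unshelve. all: by end_near. Qed.

Lemma uboundedP z : ubounded z -> exists2 B, 0 < B & \forall m \near F, `|z m| <= B.
Proof.
move=> [B zB]; have B0 : 0 <= B.
  have [m] : exists m, `|z m| <= B by exact: filter_ex zB.
  exact: le_trans.
exists (B + 1); first by rewrite ltr_wpDl.
by near=> m; rewrite (@le_trans _ _ B) ?lerDl //; near: m.
Unshelve. all: by end_near. Qed.

Lemma ulim0_bounded z w : ulim z 0 -> ubounded w -> ulim (fun m => z m * w m) 0.
Proof.
move=> z0 /uboundedP[B B0 wB] e e0; near=> m.
have zm : `|z m - 0| < e / B by near: m; apply: z0; rewrite divr_gt0.
have wm : `|w m| <= B by near: m.
rewrite subr0 normrM; rewrite subr0 in zm.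
apply: (@le_lt_trans _ _ (`|z m| * B)); first by rewrite ler_wpM2l.
by rewrite -ltr_pdivlMr.
Unshelve. all: by end_near. Qed.

Lemma ulim_sub0 z l : ulim (fun m => z m - l) 0 <-> ulim z l.
Proof.
by split=> zl e e0; near=> m; [rewrite -[z m - l]subr0|rewrite subr0]; near: m; exact: zl.
Unshelve. all: by end_near. Qed.

Lemma ulimM z w l l' : ulim z l -> ulim w l' -> ulim (fun m => z m * w m) (l * l').
Proof.
move=> zl wl; apply/ulim_sub0.
have H1 : ulim (fun m => (z m - l) * w m) 0.
  by apply: ulim0_bounded (ulim_bounded wl); apply/ulim_sub0.
have H2 : ulim (fun m => (w m - l') * l) 0.
  by apply: ulim0_bounded; [apply/ulim_sub0|exact: (ulim_bounded (ulim_cst l))].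
have := ulimD H1 H2; rewrite addr0; apply: ulim_ext => m; ring.
Qed.

Lemma ulim_sum (I : Type) (r : seq I) (P : pred I) (f : I -> nat -> K) (l : I -> K) :
  (forall i, P i -> ulim (f i) (l i)) ->
  ulim (fun m => \sum_(i <- r | P i) f i m) (\sum_(i <- r | P i) l i).
Proof.
move=> H; elim: r => [|i r IH].
  by rewrite big_nil; apply: ulim_ext (ulim_cst 0) => m; rewrite big_nil.
rewrite big_cons; case: ifP => Pi; last first.
  by apply: ulim_ext IH => m; rewrite big_cons Pi.
by apply: ulim_ext (ulimD (H i Pi) IH) => m; rewrite big_cons Pi.
Qed.

Lemma ulim_prod (I : Type) (r : seq I) (P : pred I) (f : I -> nat -> K) (l : I -> K) :
  (forall i, P i -> ulim (f i) (l i)) ->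
  ulim (fun m => \prod_(i <- r | P i) f i m) (\prod_(i <- r | P i) l i).
Proof.
move=> H; elim: r => [|i r IH].
  by rewrite big_nil; apply: ulim_ext (ulim_cst 1) => m; rewrite big_nil.
rewrite big_cons; case: ifP => Pi; last first.
  by apply: ulim_ext IH => m; rewrite big_cons Pi.
by apply: ulim_ext (ulimM (H i Pi) IH) => m; rewrite big_cons Pi.
Qed.

Lemma ulimX z l n : ulim z l -> ulim (fun m => z m ^+ n) (l ^+ n).
Proof.
move=> zl; elim: n => [|n IH].
  by rewrite expr0; apply: ulim_ext (ulim_cst 1) => m; rewrite expr0.
by rewrite exprS; apply: ulim_ext (ulimM zl IH) => m; rewrite exprS.
Qed.

Lemma ulim_neq0 z l : ulim z l -> l != 0 -> \forall m \near F, z m != 0.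
Proof.
move=> zl l0; near=> m; apply/eqP => zm0.
have : `|z m - l| < `|l| by near: m; apply: zl; rewrite normr_gt0.
by rewrite zm0 sub0r normrN ltxx.
Unshelve. all: by end_near. Qed.

Lemma ulimV z l : ulim z l -> l != 0 -> ulim (fun m => (z m)^-1) l^-1.
Proof.
move=> zl l0; have b : ubounded (fun m => (z m)^-1).
  exists (`|l| / 2)^-1; near=> m.
  have zm : `|z m - l| < `|l| / 2 by near: m; apply: zl; rewrite divr_gt0 ?normr_gt0.
  have lz : `|l| / 2 <= `|z m|.
    rewrite -(lerD2l (`|l| / 2)) -splitr.
    rewrite -{1}(subrK (z m) l); apply: le_trans (ler_normD _ _) _.
    by rewrite lerD2r distrC ltW.
  have z0 : 0 < `|z m| by apply: lt_le_trans lz; rewrite divr_gt0 ?normr_gt0.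
  by rewrite normfV lef_pV2 // posrE divr_gt0 ?normr_gt0.
have H : ulim (fun m => (z m - l) * (- ((z m)^-1 * l^-1))) 0.
  apply: ulim0_bounded; first exact/ulim_sub0.
  case: b => B zB; exists (B * `|l^-1|); near=> m.
  by rewrite normrN normrM ler_wpM2r //; near: m.
apply/ulim_sub0; apply: ulim_near H _; near=> m.
have z0 : z m != 0 by near: m; exact: ulim_neq0 zl l0.
by field; rewrite z0 l0.
Unshelve. all: by end_near. Qed.

Lemma ulim_unique z l l' : ulim z l -> ulim z l' -> l = l'.
Proof.
move=> zl zl'; apply/eqP; rewrite -subr_eq0 -normr_eq0; apply/negPn/negP => d0.
have e0 : 0 < `|l - l'| / 2 by rewrite divr_gt0 // lt_neqAle eq_sym d0 normr_ge0.
have : \forall m \near F, False.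
  near=> m; have : `|l - l'| < `|l - l'|; last by rewrite ltxx.
  rewrite {2}(splitr `|l - l'|) -[in ltLHS](subrK (z m) l) -addrA.
  apply: le_lt_trans (ler_normD _ _) _; apply: ltrD; last by near: m; exact: zl'.
  by rewrite distrC; near: m; exact: zl.
by move=> /filter_ex[].
Unshelve. all: by end_near. Qed.

Lemma ulim_norm_le z l B : ulim z l -> (\forall m \near F, `|z m| <= B) -> `|l| <= B.
Proof.
move=> zl zB; have [m0 zm0] : exists m, `|z m| <= B by exact: filter_ex zB.
have Breal : B \is Num.real by rewrite ger0_real // (le_trans _ zm0).
rewrite real_leNgt ?normr_real //; apply/negP => Bl.
have : \forall m \near F, False.
  near=> m; have : `|z m - l| < `|l| - B by near: m; apply: zl; rewrite subr_gt0.
  rewrite ltrBrDr => H; have : `|l| < `|l|; last by rewrite ltxx.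
  apply: le_lt_trans H; rewrite -{1}(subrK (z m) l); apply: le_trans (ler_normD _ _) _.
  by rewrite distrC lerD2l; near: m.
by move=> /filter_ex[].
Unshelve. all: by end_near. Qed.

(** An ultrafilter decides each bound, so a sequence that is not bounded exceeds every bound along
    [F]. *)
Lemma ubounded_or_inv z : ubounded z \/ ulim (fun m => (z m)^-1) 0.
Proof.
have [|nb] := pselect (ubounded z); [by left|right] => e e0.
have : ~ (\forall m \near F, `|z m| <= e^-1) by move=> H; apply: nb; exists e^-1.
move=> /ultraP H; near=> m; rewrite subr0 normfV.
have : ~ `|z m| <= e^-1 by near: m.
move=> /negP; rewrite -real_ltNge ?normr_real ?gtr0_real ?invr_gt0 // => ez.
by rewrite invf_plt ?posrE // (lt_trans _ ez) // invr_gt0.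
Unshelve. all: by end_near. Qed.

End UltraLimits.

Section ComplexLimits.
Variables (R : realType) (F : set_system nat).
Context {FU : UltraFilter F}.

Let FP : ProperFilter F := ultra_proper.
Local Existing Instance FP.

(** The limit is the supremum of the [t] that stay below the sequence along [F]; a larger [t] fails
    to do so, and the ultrafilter turns this failure into an upper bound along [F]. *)
Lemma ulim_exists_real (r : nat -> R) : ubounded F r -> exists l, ulim F r l.
Proof.
move=> /uboundedP[B B0 rB]; pose E := [set t : R | \forall m \near F, t <= r m].
have supE : has_sup E.
  split; first by exists (- B); near=> m; move: (near rB m); rewrite ler_norml => /(_ _)/andP[].
  exists B => t Et; have [m [tm mB]] : exists m, t <= r m /\ `|r m| <= B.
    by apply: (@filter_ex _ F); near=> m; split; near: m.
  by rewrite (le_trans tm) // (le_trans (ler_norm _)).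
exists (sup E) => e e0.
have [t Et te] := sup_adherent e0 supE.
have Ee : \forall m \near F, ~ (sup E + e <= r m).
  apply: ultraP => H; have := sup_upper_bound supE H.
  by rewrite gerDl leNgt e0.
near=> m; rewrite ltr_distl; apply/andP; split.
  by apply: lt_le_trans te _; near: m.
by rewrite ltNge; apply/negP; near: m.
Unshelve. all: by end_near. Qed.

Lemma normc_real_complex (x : R) : `|real_complex R x| = real_complex R `|x|.
Proof. by rewrite normc_def /= expr0n addr0 sqrtr_sqr. Qed.

Lemma posc_re (e : R[i]) : 0 < e -> e = real_complex R (complex.Re e) /\ 0 < complex.Re e.
Proof.
case: e => a b; rewrite ltcE /= => /andP[/eqP -> a0].
by split.
Qed.

Lemma ulim_real_complex (r : nat -> R) l :
  ulim F r l -> ulim F (fun m => real_complex R (r m)) (real_complex R l).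
Proof.
move=> rl e /posc_re[-> e0]; near=> m.
rewrite -rmorphB /= normc_real_complex ltcR; near: m; exact: rl.
Unshelve. all: by end_near. Qed.

Lemma normc_le_re (z B : R[i]) : `|z| <= B ->
  `|complex.Re z| <= complex.Re B /\ `|complex.Im z| <= complex.Re B.
Proof.
move=> zB; split.
  by have := le_trans (normc_ge_Re z) zB; rewrite lecE => /andP[].
have : `|complex.Re (z * 'i%C)|%:C%C <= B.
  apply: le_trans (normc_ge_Re _) _; rewrite normrM.
  by rewrite [X in _ * X]normc_def /= expr0n expr1n add0r sqrtr1 mulr1.
by rewrite ReiNIm normrN lecE => /andP[].
Qed.

Lemma ulim_exists (z : nat -> R[i]) : ubounded F z -> exists l, ulim F z l.
Proof.
move=> [B zB].
have [a za] : exists a, ulim F (fun m => complex.Re (z m)) a.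
  apply: ulim_exists_real; exists (complex.Re B); near=> m.
  by apply: (normc_le_re _).1; near: m.
have [b zb] : exists b, ulim F (fun m => complex.Im (z m)) b.
  apply: ulim_exists_real; exists (complex.Re B); near=> m.
  by apply: (normc_le_re _).2; near: m.
exists (real_complex R a + 'i%C * real_complex R b).
apply: ulim_ext (ulimD (ulim_real_complex za)
  (ulimM (ulim_cst _) (ulim_real_complex zb))) => m.
by rewrite -complexE.
Unshelve. all: by end_near. Qed.

End ComplexLimits.

Lemma nonprincipal_ultrafilter :
  exists2 F : set_system nat, UltraFilter F & forall N, F [set m | (N <= m)%N].
Proof.
have [F [FU FE]] := ultraFilterLemma eventually_filter.
by exists F => // N; apply: FE; exists N.
Qed.

(** * Monomials and convexity through logarithms *)

Section LogNorm.
Variable R : realType.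
Implicit Types z w : R[i].

Definition lognorm z : R := exp.ln (Normc.normc z).

Lemma normc_gt0 z : z != 0 -> 0 < Normc.normc z.
Proof.
move=> z0; have : 0 < `|z| by rewrite normr_gt0.
by rewrite -[ `|z| ]/(real_complex R (Normc.normc z)) -[0]/(real_complex R 0) ltcR.
Qed.

Lemma lognormM z w : z != 0 -> w != 0 -> lognorm (z * w) = lognorm z + lognorm w.
Proof. by move=> z0 w0; rewrite /lognorm Normc.normcM exp.lnM // posrE normc_gt0. Qed.

Lemma lognormV z : z != 0 -> lognorm z^-1 = - lognorm z.
Proof. by move=> z0; rewrite /lognorm Normc.normcV exp.lnV // posrE normc_gt0. Qed.

Lemma lognorm1 : lognorm 1 = 0.
Proof. by rewrite /lognorm Normc.normc1 exp.ln1. Qed.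

Lemma lognormX z n : z != 0 -> lognorm (z ^+ n) = n%:R * lognorm z.
Proof.
move=> z0; elim: n => [|n IH]; first by rewrite expr0 lognorm1 mul0r.
by rewrite exprS lognormM ?expf_neq0 // IH -natr1 mulrDl mul1r addrC.
Qed.

Lemma lognorm_prod (I : finType) (f : I -> R[i]) : (forall i, f i != 0) ->
  lognorm (\prod_i f i) = \sum_i lognorm (f i).
Proof.
move=> f0; suff [] : lognorm (\prod_i f i) = \sum_i lognorm (f i) /\ \prod_i f i != 0 by [].
elim/big_rec2: _ => [|i s p _ [IH p0]]; first by rewrite lognorm1 oner_eq0.
by rewrite lognormM // IH mulf_neq0.
Qed.

Lemma ler_lognorm z w : z != 0 -> w != 0 -> (lognorm z <= lognorm w) = (`|z| <= `|w|).
Proof.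
by move=> z0 w0; rewrite /lognorm exp.ler_ln ?posrE ?normc_gt0 // -lecR.
Qed.

Variables (F : set_system nat).
Context {FU : UltraFilter F}.
Let FP : ProperFilter F := ultra_proper.
Local Existing Instance FP.

Lemma lognorm_ubound (s : nat -> R[i]) : (\forall m \near F, s m != 0) -> ubounded F s ->
  exists B, \forall m \near F, lognorm (s m) <= B.
Proof.
move=> s0 [B sB]; exists (lognorm B); near=> m.
have sm0 : s m != 0 by near: m.
have sB' : `|s m| <= B by near: m.
have B0 : 0 < B by apply: lt_le_trans sB'; rewrite normr_gt0.
have Bn0 : B != 0 by rewrite lt0r_neq0.
by rewrite ler_lognorm // (gtr0_norm B0).
Unshelve. all: by end_near. Qed.

Lemma ubounded_lognorm (s : nat -> R[i]) B : (\forall m \near F, s m != 0) ->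
  (\forall m \near F, lognorm (s m) <= B) -> ubounded F s.
Proof.
move=> s0 sB; pose E : R[i] := real_complex R (sequences.expR B).
have E0 : 0 < E by rewrite -[0]/(real_complex R 0) ltcR exp.expR_gt0.
exists E; near=> m.
have sm0 : s m != 0 by near: m.
have En0 : E != 0 by rewrite lt0r_neq0.
rewrite -[E](gtr0_norm E0) -(ler_lognorm sm0 En0).
have -> : lognorm E = B; last by near: m.
rewrite /lognorm (_ : Normc.normc E = sequences.expR B) ?exp.expRK //.
by apply: (@complexI R); rewrite -[LHS]/`|E| gtr0_norm.
Unshelve. all: by end_near. Qed.

Variables (T : finType) (n : nat) (b : T -> 'I_n -> nat).

Lemma lognorm_monom (x : 'I_n -> R[i]) a : (forall i, x i != 0) ->
  lognorm (monom b x a) = \sum_i (b a i)%:R * lognorm (x i).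
Proof.
move=> x0; rewrite /monom lognorm_prod => [|i]; last by rewrite expf_neq0.
by apply: eq_bigr => i _; rewrite lognormX.
Qed.

(** [lognorm] makes a monomial linear in its exponent, and a weighted average of values is bounded
    by any common bound on them. *)
Lemma monom_hull (x : 'I_n -> R[i]) (a a0 : T) (m : nat) (w : 'I_m -> R) (e : 'I_m -> T) :
  (forall i, x i != 0) -> (forall s, 0 <= w s) -> \sum_s w s = 1 ->
  (forall i, (b a i)%:R = \sum_s w s * (b (e s) i)%:R) ->
  (forall s, `|monom b x (e s)| <= `|monom b x a0|) -> `|monom b x a| <= `|monom b x a0|.
Proof.
move=> x0 w0 w1 wb le_a0; have xn0 a' := monom_neq0 b a' x0.
rewrite -ler_lognorm // lognorm_monom //.
rewrite [leRHS](_ : _ = \sum_s w s * lognorm (monom b x a0)); last first.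
  by rewrite -mulr_suml w1 mul1r.
rewrite [leLHS](_ : _ = \sum_s w s * lognorm (monom b x (e s))); last first.
  under [RHS]eq_bigr => s _ do rewrite lognorm_monom // mulr_sumr.
  rewrite exchange_big; apply: eq_bigr => i _ /=.
  by rewrite wb mulr_suml; apply: eq_bigr => s _; rewrite mulrA.
by apply: ler_sum => s _; rewrite ler_wpM2l // ler_lognorm.
Qed.

End LogNorm.

(** * Solutions of generic systems do not escape *)

Section Genericity.
Variables (R : realType) (T : finType) (n k : nat).
Variables (jj : T -> 'I_k) (b : T -> 'I_n -> nat).

(* [c] does not lie in the closure of the hypersurfaces of
   [torus_family_in_hypersurface]; hence every face system of [c] is a smooth
   complete intersection in the torus. *)
Definition faces_generic (c : T -> R[i]) :=
  forall (F : set_system nat), UltraFilter F ->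
  forall (S : {set T}) (s0 : T), s0 \in S ->
  forall (cm : nat -> T -> R[i]) (d : T -> R[i]) (kappa : nat -> 'I_k -> R[i])
    (x : nat -> 'I_n -> R[i]),
  (forall a, ulim F (fun m => cm m a) (c a)) ->
  (forall m a, a \in S -> cm m a = d a * (kappa m (jj a) * monom b (x m) a)) ->
  (forall j, \sum_(a in S | jj a == j) d a = 0) ->
  (forall i, \sum_(a in S) d a * (b a i)%:R = 0) -> False.

Definition orthogonal_to_faces (S : {set T}) (w : 'I_n -> R) :=
  forall a a', a \in S -> a' \in S -> jj a = jj a' ->
    \sum_i w i * ((b a i)%:R - (b a' i)%:R) = 0.

(** Asking for one suitable [w] per [S], instead of all nonzero [w], keeps this a finite list of
    open conditions: fixing a [w] for each [S] gives a linear form in [u] that must not vanish. *)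
Definition data_generic (u : 'I_n -> R[i]) :=
  forall S : {set T},
  (exists w, orthogonal_to_faces S w /\ exists i, w i != 0) ->
  exists2 w, orthogonal_to_faces S w & \sum_i real_complex R (w i) * u i != 0.

Definition ml_nondegenerate (c : T -> R[i]) (u : 'I_n -> R[i]) :=
  forall x lam, (forall i, x i != 0) -> ml_solution jj b c u x lam ->
  forall xi mu, ml_kernel jj b c x lam xi mu ->
    (forall i, xi i = 0) /\ (forall j, mu j = 0).

(** The condition [u i != 0] confines the solutions to the torus, where logarithmic coordinates make
    sense. *)
Definition ml_generic (c : T -> R[i]) (u : 'I_n -> R[i]) :=
  [/\ forall i, u i != 0, faces_generic c, data_generic u & ml_nondegenerate c u].

End Genericity.

Section UltraFinite.
Variables (F : set_system nat).
Context {FU : UltraFilter F}.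
Let FP : ProperFilter F := ultra_proper.
Local Existing Instance FP.

Lemma ultra_finite (A : finType) (f : nat -> A) : exists a, \forall m \near F, f m = a.
Proof.
apply: contrapT => /forallNP H.
have : \forall m \near F, forall a, ~ f m = a.
  by apply: filter_forall => a; apply: ultraP; exact: H.
by move=> /filter_ex[m] /(_ (f m)).
Qed.

Lemma ubounded_or_inv_neq0 (K : numFieldType) (z : nat -> K) : ubounded F z \/
  (ulim F (fun m => (z m)^-1) 0 /\ \forall m \near F, z m != 0).
Proof.
have [|nb] := pselect (ubounded F z); [by left|right].
have [//|zinf] := ubounded_or_inv (F := F) z; split=> //.
have : ~ (\forall m \near F, `|z m| <= 0) by move=> H; apply: nb; exists 0.
move=> /ultraP H; near=> m; apply/eqP => zm.
have : ~ `|z m| <= 0 by near: m.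
by rewrite zm normr0.
Unshelve. all: by end_near. Qed.

Lemma ubounded_near (K : numFieldType) (z w : nat -> K) :
  ubounded F z -> (\forall m \near F, `|w m| <= `|z m|) -> ubounded F w.
Proof.
move=> [B zB] wz; exists B; near=> m.
by rewrite (@le_trans _ _ `|z m|) //; near: m.
Unshelve. all: by end_near. Qed.

End UltraFinite.

Section Embedding.
Variables (K : nmodType) (T T0 : finType) (iota : T0 -> T).
Hypothesis iota_inj : injective iota.

Lemma sum_codom (P : pred T) (f : T -> K) : (forall a, a \notin codom iota -> f a = 0) ->
  \sum_(a | P a) f a = \sum_(a0 | P (iota a0)) f (iota a0).
Proof.
move=> f0; rewrite (bigID (mem (codom iota))) /= [X in _ + X]big1 ?addr0; last first.
  by move=> a /andP[_ /f0].
rewrite -[RHS](big_imset (fun a => f a) (h := iota) (A := [pred a0 | P (iota a0)])) /=; last first.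
  by move=> a a' _ _; exact: iota_inj.
apply: eq_bigl => a; apply/andP/imsetP => [[Pa /codomP[a0 aE]]|[a0 Pa0 ->]].
  by exists a0; rewrite // inE -aE.
by split; [|exact: codom_f].
Qed.
End Embedding.

(** * Properness: limits of solutions stay in the torus *)

Section Properness.
Variables (R : realType) (F : set_system nat).
Context {FU : UltraFilter F}.
Let FP : ProperFilter F := ultra_proper.
Local Existing Instance FP.
Variables (T T0 : finType) (n k : nat) (jj : T -> 'I_k) (b : T -> 'I_n -> nat).
Variable iota : T0 -> T.
Hypothesis iota_inj : injective iota.
Hypothesis iota_onto : forall j, exists a, jj (iota a) = j.
Hypothesis in_hull : forall a : T, exists (m : nat) (w : 'I_m -> R) (e : 'I_m -> T0),
  [/\ forall s, 0 <= w s, \sum_s w s = 1, forall s, jj (iota (e s)) = jj a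
    & forall i, (b a i)%:R = \sum_s w s * (b (iota (e s)) i)%:R].

Let jj0 a := jj (iota a).
Let b0 a := b (iota a).

(** The index of a largest monomial takes finitely many values, so the ultrafilter makes it
    independent of [m]; convexity extends the domination from the image of [iota] to all of [T]. *)
Lemma dominating_monomials (x : nat -> 'I_n -> R[i]) :
  (\forall m \near F, forall i, x m i != 0) ->
  exists2 top : 'I_k -> T0, (forall j, jj (iota (top j)) = j) &
    \forall m \near F, forall a,
      `|monom b (x m) a| <= `|monom b (x m) (iota (top (jj a)))|.
Proof.
move=> x0.
have H j : exists a1, jj (iota a1) = j /\ \forall m \near F, forall a, jj (iota a) = j ->
    `|monom b (x m) (iota a)| <= `|monom b (x m) (iota a1)|.
  have [a0 a0j] := iota_onto j.
  pose f m := [arg max_(a > a0 | jj (iota a) == j) Normc.normc (monom b (x m) (iota a))]%O.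
  have [a1 fa1] := ultra_finite f; exists a1; split.
    have [m <-] := filter_ex fa1; rewrite /f; case: arg_maxP; first exact/eqP.
    by move=> a /eqP.
  near=> m => a aj; have <- : f m = a1 by near: m.
  rewrite /f; case: arg_maxP => [|a2 _ /(_ a)]; first exact/eqP.
  by rewrite aj eqxx => /(_ isT) H; rewrite -[_ <= _]/(real_complex R _ <= real_complex R _) lecR.
have [top topP] := choice H; exists top; first by move=> j; exact: (topP j).1.
have top_max : \forall m \near F, forall j a, jj (iota a) = j ->
    `|monom b (x m) (iota a)| <= `|monom b (x m) (iota (top j))|.
  by apply: filter_forall => j; exact: (topP j).2.
near=> m; have x0m : forall i, x m i != 0 by near: m.
have tm : forall j a, jj (iota a) = j ->
    `|monom b (x m) (iota a)| <= `|monom b (x m) (iota (top j))| by near: m.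
move=> a; have [s [w [e [w0 w1 ej wb]]]] := in_hull a.
apply: (monom_hull (w := w) (e := fun s => iota (e s))) => // t.
exact: tm (ej t).
Unshelve. all: by end_near. Qed.

Variables (c : T -> R[i]) (u : 'I_n -> R[i]).
Hypothesis c_off : forall a, a \notin codom iota -> c a = 0.
Hypothesis c_faces : faces_generic jj0 b0 (fun a => c (iota a)).
Hypothesis u_generic : data_generic jj0 b0 u.

Variables (cm : nat -> T -> R[i]) (um x : nat -> 'I_n -> R[i]) (lam : nat -> 'I_k -> R[i]).
Hypothesis cm_lim : forall a, ulim F (fun m => cm m a) (c a).
Hypothesis um_lim : forall i, ulim F (fun m => um m i) (u i).
Hypothesis x_neq0 : \forall m \near F, forall i, x m i != 0.
Hypothesis solm : \forall m \near F, ml_solution jj b (cm m) (um m) (x m) (lam m).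

Local Notation mon m a := (monom b (x m) a).

Lemma monom_near_neq0 a : \forall m \near F, mon m a != 0.
Proof. by near=> m; apply: monom_neq0; near: m. Unshelve. all: by end_near. Qed.

(* Rescale the monomials of each polynomial by a dominating one and the
   multipliers accordingly.  The limit ratios [r] solve a face system, whose
   gradients are independent; so the rescaled multipliers [mu] converge.  Since
   [u] is orthogonal to no direction orthogonal to the faces, the faces span
   and the coordinates of [x] stay bounded. *)
Theorem ml_solutions_proper : exists (x' : 'I_n -> R[i]) (lam' : 'I_k -> R[i]),
  [/\ forall i, x' i != 0, forall i, ulim F (fun m => x m i) (x' i)
    & forall j, ulim F (fun m => lam m j) (lam' j)].
Proof.
have [top topj top_max] := dominating_monomials x_neq0.
pose rho m a := mon m a / mon m (iota (top (jj a))).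
have rho_bounded a : ubounded F (fun m => rho m a).
  exists 1; near=> m.
  have t0 : mon m (iota (top (jj a))) != 0 by near: m; exact: monom_near_neq0.
  rewrite normrM normfV ler_pdivrMr ?normr_gt0 // mul1r.
  have tm : forall a, `|mon m a| <= `|mon m (iota (top (jj a)))| by near: m.
  exact: tm.
have [r rP] := choice (fun a => ulim_exists (rho_bounded a)).
have mon_rho : \forall m \near F, forall a, mon m a = rho m a * mon m (iota (top (jj a))).
  by apply: filter_forall => a; near=> m; rewrite /rho divfK //; near: m; exact: monom_near_neq0.
have r_top j : r (iota (top j)) = 1.
  apply: ulim_unique (rP _) _; apply: ulim_near (ulim_cst 1) _; near=> m.
  by rewrite /rho topj divff //; near: m; exact: monom_near_neq0.
(* Coefficients outside the image of [iota] tend to 0 while their factors converge, so the extra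
   monomials disappear in the limit. *)
have lim_sum (P : pred T) (g : nat -> T -> R[i]) (gl : T -> R[i]) :
    (forall a, P a -> ulim F (fun m => g m a) (gl a)) ->
    ulim F (fun m => \sum_(a | P a) cm m a * g m a)
      (\sum_(a | P (iota a)) c (iota a) * gl (iota a)).
  move=> gP; rewrite -(@sum_codom _ _ _ iota iota_inj P (fun a => c a * gl a)); last first.
    by move=> a /c_off ->; rewrite mul0r.
  by apply: ulim_sum => a Pa; apply: ulimM => //; apply: gP.
have face_eq j : \sum_(a | jj0 a == j) c (iota a) * r (iota a) = 0.
  apply: ulim_unique (lim_sum (fun a => jj a == j) rho r _) _ => //.
  apply: ulim_near (ulim_cst 0) _; near=> m.
  have [_ /(_ j)] : ml_solution jj b (cm m) (um m) (x m) (lam m) by near: m.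
  have t0 : mon m (iota (top j)) != 0 by near: m; exact: monom_near_neq0.
  move=> H; apply: (mulIf t0); rewrite mul0r -[LHS]H mulr_suml.
  apply: eq_bigr => a /eqP aj; rewrite -mulrA; congr (_ * _).
  have mr : forall a, mon m a = rho m a * mon m (iota (top (jj a))) by near: m.
  by rewrite -{1}aj -mr.
(* The monomials comparable to a dominating one, that is, the face system selected by the
   sequence. *)
pose S : {set T0} := [set a | r (iota a) != 0]%SET.
pose g j i := \sum_(a | jj0 a == j) c (iota a) * r (iota a) * (b0 a i)%:R.
have g_free (nu : 'I_k -> R[i]) : (forall i, \sum_j nu j * g j i = 0) -> forall j, nu j = 0.
  move=> nug j1; apply/eqP/negPn/negP => nuj1.
  (* A nontrivial relation [nu] would give, with [d], [kappa] and the points [1 / x m], coefficients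
     [c' m a] equal near the limit to [c * r / rho] on [S']. They tend to [c], which [faces_generic]
     forbids. *)
  pose S' : {set T0} := [set a in S | nu (jj0 a) != 0]%SET.
  have topS' : top j1 \in S' by rewrite !inE r_top oner_eq0 /jj0 topj nuj1.
  pose d a := nu (jj0 a) * (c (iota a) * r (iota a)).
  pose kappa m j := (nu j)^-1 * mon m (iota (top j)).
  pose y m i := (x m i)^-1.
  pose c' m a := if a \in S' then d a * (kappa m (jj0 a) * monom b0 (y m) a) else c (iota a).
  have dE (P : pred T0) (f : T0 -> R[i]) :
      \sum_(a in S' | P a) d a * f a = \sum_(a | P a) d a * f a.
    rewrite [RHS](bigID (mem S')) /= [X in _ + X]big1 ?addr0.
      by apply: eq_bigl => a; rewrite andbC.
    move=> a /andP[_]; rewrite !inE negb_and !negbK => /orP[] /eqP H; rewrite /d H; ring.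
  apply: (c_faces FU topS' (cm := c') (d := d) (kappa := kappa) (x := y)).
  - move=> a; have [aS|aS] := boolP (a \in S'); last first.
      by apply: ulim_ext (ulim_cst _) => m; rewrite /c' (negbTE aS).
    have ra : r (iota a) != 0 by move: aS; rewrite !inE => /andP[].
    have nua : nu (jj0 a) != 0 by move: aS; rewrite !inE => /andP[].
    have H : ulim F (fun m => c (iota a) * r (iota a) / rho m (iota a)) (c (iota a)).
      by rewrite -[X in ulim _ _ X](mulfK ra); apply: ulimM (ulim_cst _) (ulimV (rP _) ra).
    apply: ulim_near H _; near=> m.
    have m0 : mon m (iota a) != 0 by near: m; exact: monom_near_neq0.
    have t0 : mon m (iota (top (jj0 a))) != 0 by near: m; exact: monom_near_neq0.
    rewrite /c' aS /d /kappa (_ : monom b0 (y m) a = (mon m (iota a))^-1).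
      by rewrite /rho; field; rewrite m0 nua t0.
    by rewrite -monom_inv.
  - by move=> m a aS; rewrite /c' aS.
  - move=> j; transitivity (\sum_(a in S' | jj0 a == j) d a * 1).
      by apply: eq_bigr => a _; rewrite mulr1.
    rewrite (dE (fun a => jj0 a == j) (fun=> 1)).
    rewrite (eq_bigr (fun a => nu j * (c (iota a) * r (iota a)))).
      by rewrite -mulr_sumr face_eq mulr0.
    by move=> a /eqP <-; rewrite mulr1.
  - move=> i; transitivity (\sum_(a in S' | xpredT a) d a * (b0 a i)%:R).
      by apply: eq_bigl => a; rewrite andbT.
    rewrite (dE xpredT (fun a => (b0 a i)%:R)).
    rewrite -[RHS](nug i) (partition_big jj0 xpredT) //=.
    apply: eq_bigr => j _; rewrite /g mulr_sumr; apply: eq_bigr => a /eqP <-.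
    by rewrite /d; ring.
pose mu m j := lam m j * mon m (iota (top j)).
have mu_eq : \forall m \near F, forall i,
    um m i = \sum_a cm m a * (mu m (jj a) * rho m a * (b a i)%:R).
  near=> m => i.
  have [/(_ i) -> _] : ml_solution jj b (cm m) (um m) (x m) (lam m) by near: m.
  have mr : forall a, mon m a = rho m a * mon m (iota (top (jj a))) by near: m.
  by apply: eq_bigr => a _; rewrite mr /mu; ring.
have lim_g (nu : nat -> 'I_k -> R[i]) (nul : 'I_k -> R[i]) i :
    (forall j, ulim F (fun m => nu m j) (nul j)) ->
    ulim F (fun m => \sum_a cm m a * (nu m (jj a) * rho m a * (b a i)%:R)) (\sum_j nul j * g j i).
  move=> nuP; have -> : \sum_j nul j * g j i
      = \sum_(a | xpredT (iota a)) c (iota a) * (nul (jj (iota a)) * r (iota a) * (b (iota a) i)%:R).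
    rewrite [RHS](partition_big jj0 xpredT) //=; apply: eq_bigr => j _.
    rewrite mulr_sumr; apply: eq_bigr => a /eqP <-; rewrite /jj0 /b0; ring.
  apply: (lim_sum xpredT _ (fun a => nul (jj a) * r a * (b a i)%:R)) => a _.
  by apply: ulimM; [apply: ulimM|exact: ulim_cst].
have mu_bounded j : ubounded F (fun m => mu m j).
  pose top_mu m := [arg max_(j' > j) Normc.normc (mu m j')]%O.
  have [j0 j0P] := ultra_finite top_mu.
  have mu_le : \forall m \near F, forall j', `|mu m j'| <= `|mu m j0|.
    near=> m => j'; have <- : top_mu m = j0 by near: m.
    rewrite /top_mu; case: arg_maxP => // j2 _ /(_ j' isT).
    by rewrite -[_ <= _]/(real_complex R _ <= real_complex R _) lecR.
  have [b0mu|[mu_inf mu0]] := ubounded_or_inv_neq0 (F := F) (fun m => mu m j0).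
    by apply: ubounded_near b0mu _; near=> m; move: (j); near: m.
  (* If the largest multiplier is unbounded, dividing the equations by it makes the left side tend
     to 0 and leaves a relation between the [g j] with coefficient 1 at [j0]. *)
  pose nu m j' := mu m j' / mu m j0.
  have nu_bounded j' : ubounded F (fun m => nu m j').
    exists 1; near=> m; have m0 : mu m j0 != 0 by near: m.
    rewrite normrM normfV ler_pdivrMr ?normr_gt0 // mul1r.
    have ml : forall j', `|mu m j'| <= `|mu m j0| by near: m.
    exact: ml.
  have [nul nulP] := choice (fun j' => ulim_exists (nu_bounded j')).
  have nul0 : forall j', nul j' = 0.
    apply: g_free => i; apply: ulim_unique (lim_g nu nul i nulP) _.
    have H : ulim F (fun m => um m i / mu m j0) 0.
      by rewrite -(mulr0 (u i)); apply: ulimM.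
    apply: ulim_near H _.
    near=> m; have m0 : mu m j0 != 0 by near: m.
    have -> : um m i = \sum_a cm m a * (mu m (jj a) * rho m a * (b a i)%:R).
      by move: (i); near: m.
    by rewrite mulr_suml; apply: eq_bigr => a _; rewrite /nu; ring.
  have : nul j0 = 1.
    apply: ulim_unique (nulP j0) _; apply: ulim_near (ulim_cst 1) _; near=> m.
    by rewrite /nu divff //; near: m.
  by rewrite nul0 => /eqP; rewrite eq_sym oner_eq0.
have [mul mulP] := choice (fun j => ulim_exists (mu_bounded j)).
have u_eq i : u i = \sum_j mul j * g j i.
  apply: ulim_unique (um_lim i) _; apply: ulim_near (lim_g mu mul i mulP) _.
  by near=> m; apply/esym; move: (i); near: m.
have faces_span (w : 'I_n -> R) : orthogonal_to_faces jj0 b0 S w -> forall i, w i = 0.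
  move=> Sw i0; apply/eqP/negPn/negP => wi0.
  have [|v Sv] := @u_generic S; first by exists w; split=> //; exists i0.
  (* [W] is constant on the part of [S] in each polynomial, so pairing [v] with
     [u = \sum_j mul j * g j] yields multiples of the face equations, all 0. *)
  case/eqP; pose W a := \sum_i real_complex R (v i) * (b0 a i)%:R.
  have WE a : a \in S -> W a = W (top (jj0 a)).
    move=> aS; apply/eqP; rewrite -subr_eq0 -sumrB; apply/eqP.
    rewrite -[RHS](rmorph0 (real_complex R)) -(Sv a (top (jj0 a)) aS); last 2 first.
    - by rewrite inE r_top oner_eq0.
    - by rewrite /jj0 topj.
    rewrite rmorph_sum; apply: eq_bigr => i _ /=.
    by rewrite rmorphM rmorphB /= !rmorph_nat mulrBr.
  transitivity (\sum_j mul j * \sum_(a | jj0 a == j) c (iota a) * r (iota a) * W a).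
    under eq_bigr => i _ do rewrite u_eq mulr_sumr.
    rewrite exchange_big; apply: eq_bigr => j _ /=.
    transitivity (mul j * \sum_i real_complex R (v i) * g j i).
      by rewrite mulr_sumr; apply: eq_bigr => i _; rewrite mulrCA.
    congr (_ * _); rewrite /g; under eq_bigr => i _ do rewrite mulr_sumr.
    rewrite exchange_big; apply: eq_bigr => a _ /=.
    by rewrite /W mulr_sumr; apply: eq_bigr => i _; rewrite mulrCA.
  apply: big1 => j _; rewrite (eq_bigr (fun a => c (iota a) * r (iota a) * W (top j))).
    by rewrite -mulr_suml face_eq mul0r mulr0.
  move=> a /eqP aj; have [aS|] := boolP (a \in S); first by rewrite WE // aj.
  by rewrite inE negbK => /eqP ->; rewrite mulr0 !mul0r.
have log_bounded i : exists B, \forall m \near F, `|lognorm (x m i)| <= B.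
  (* A left kernel vector of [D] is orthogonal to the faces, hence 0. A right inverse [E] then
     recovers each [lognorm (x m i)] from the logarithms of the ratios [rho] on [S], bounded because
     these ratios have nonzero limits. *)
  pose D : 'M[R]_(n, #|T0|) := \matrix_(i, q)
    if enum_val q \in S then (b0 (enum_val q) i)%:R - (b0 (top (jj0 (enum_val q))) i)%:R else 0.
  have Dfree : row_free D.
    rewrite -kermx_eq0; apply/negPn/negP => /rowV0Pn[w /sub_kermxP wD /rV0Pn[i0]].
    apply/negP; rewrite negbK; apply/eqP; move: i0; apply: (faces_span (fun i => w 0 i)).
    have Wtop a : a \in S -> \sum_i w 0 i * ((b0 a i)%:R - (b0 (top (jj0 a)) i)%:R) = 0.
      move=> aS; have /rowP/(_ (enum_rank a)) := wD; rewrite !mxE => H; rewrite -[RHS]H.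
      by apply: eq_bigr => i1 _; rewrite mxE enum_rankK aS.
    move=> a a' aS a'S aa'.
    transitivity (\sum_i w 0 i * ((b0 a i)%:R - (b0 (top (jj0 a)) i)%:R)
                - \sum_i w 0 i * ((b0 a' i)%:R - (b0 (top (jj0 a')) i)%:R)).
      by rewrite -sumrB; apply: eq_bigr => i1 _; rewrite aa'; ring.
    by rewrite !Wtop // subrr.
  have [E DE] := row_freeP Dfree.
  have rho_log a : a \in S -> exists B, \forall m \near F, `|lognorm (rho m (iota a))| <= B.
    rewrite inE => ra.
    have rho0 : \forall m \near F, rho m (iota a) != 0 by exact: ulim_neq0 (rP _) ra.
    have [B1 B1P] := lognorm_ubound rho0 (rho_bounded (iota a)).
    have rhoV0 : \forall m \near F, (rho m (iota a))^-1 != 0.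
      by near=> m; rewrite invr_eq0; near: m.
    have [B2 B2P] := lognorm_ubound rhoV0 (ulim_bounded (ulimV (rP _) ra)).
    exists (Num.max B1 B2); near=> m.
    have r0 : rho m (iota a) != 0 by near: m.
    have h1 : lognorm (rho m (iota a)) <= B1 by near: m.
    have h2 : lognorm (rho m (iota a))^-1 <= B2 by near: m.
    rewrite lognormV // in h2.
    by rewrite ler_norml lerNl !le_max h1 h2 orbT.
  have [BB BBP] : exists BB : T0 -> R, \forall m \near F, forall a, a \in S ->
      `|lognorm (rho m (iota a))| <= BB a.
    have /choice[BB BBP] a : exists B, \forall m \near F, a \in S -> `|lognorm (rho m (iota a))| <= B.
      have [aS|aS] := boolP (a \in S); last by exists 0; apply: nearW.
      by have [B BP] := rho_log a aS; exists B; apply: filterS BP.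
    by exists BB; apply: filter_forall.
  exists (\sum_q `|BB (enum_val q)| * `|E q i|); near=> m.
  have x0 : forall i, x m i != 0 by near: m.
  have BBm : forall a, a \in S -> `|lognorm (rho m (iota a))| <= BB a by near: m.
  pose l : 'rV[R]_n := \row_i lognorm (x m i).
  have lE : lognorm (x m i) = \sum_q (l *m D) 0 q * E q i.
    transitivity ((l *m (D *m E)) 0 i); first by rewrite DE mulmx1 mxE.
    by rewrite mulmxA mxE.
  rewrite lE; apply: le_trans (ler_norm_sum _ _ _) _; apply: ler_sum => q _.
  rewrite normrM ler_wpM2r // mxE.
  have [qS|qS] := boolP (enum_val q \in S); last first.
    by rewrite big1 ?normr0 // => i1 _; rewrite !mxE (negbTE qS) mulr0.
  apply: le_trans (ler_norm (BB (enum_val q))); apply: le_trans (BBm _ qS).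
  rewrite (_ : \sum_j _ = lognorm (rho m (iota (enum_val q)))) //.
  rewrite /rho lognormM ?invr_eq0 ?monom_neq0 // lognormV ?monom_neq0 // !lognorm_monom //.
  by rewrite -sumrB; apply: eq_bigr => i1 _; rewrite !mxE qS /b0 /jj0; ring.
have x_near i : \forall m \near F, x m i != 0.
  by near=> m; move: (i); near: m.
have x_bounded i : ubounded F (fun m => x m i).
  have [B BP] := log_bounded i; apply: ubounded_lognorm (x_near i) _ => //.
  by apply: filterS BP => m; rewrite ler_norml => /andP[_ h]; exact: h.
have xV_bounded i : ubounded F (fun m => (x m i)^-1).
  have [B BP] := log_bounded i; apply: (@ubounded_lognorm _ _ _ _ B).
    by apply: filterS (x_near i) => m; rewrite invr_eq0.
  near=> m; rewrite lognormV; last by near: m.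
  have : `|lognorm (x m i)| <= B by near: m.
  by rewrite ler_norml => /andP[h _]; rewrite lerNl.
have [x' x'P] := choice (fun i => ulim_exists (x_bounded i)).
have x'0 i : x' i != 0.
  have [y yP] := ulim_exists (xV_bounded i).
  have : x' i * y = 1.
    apply: ulim_unique (ulimM (x'P i) yP) _; apply: ulim_near (ulim_cst 1) _.
    by near=> m; rewrite divff //; near: m.
  by apply: contra_eq_neq => ->; rewrite mul0r eq_sym oner_eq0.
have mon_lim a : ulim F (fun m => mon m a) (monom b x' a).
  by apply: ulim_prod => i _; apply: ulimX.
exists x', (fun j => mul j / monom b x' (iota (top j))); split=> // j.
apply: ulim_near (ulimM (mulP j)
  (ulimV (mon_lim (iota (top j))) (monom_neq0 b (iota (top j)) x'0))) _; near=> m; rewrite /mu mulfK //.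
by near: m; exact: monom_near_neq0.
Unshelve. all: by end_near. Qed.

End Properness.

(** * Local behaviour of the solutions *)

Section StrictDifferences.
Variables (K : numFieldType) (F : set_system nat).
Context {FU : UltraFilter F}.
Let FP : ProperFilter F := ultra_proper.
Local Existing Instance FP.
Variable h : nat -> K.
Hypothesis h_lim0 : ulim F h 0.
Hypothesis h_neq0 : \forall m \near F, h m != 0.
Implicit Types p q : nat -> K.

(* [p] and [q] are the values of a function at two sequences of points whose
   difference is [h] times a convergent direction; [d] is the derivative of the
   function, at the limit point, along the limit direction. *)
Definition sdiff p q (a d : K) :=
  ulim F p a /\ ulim F (fun m => (q m - p m) / h m) d.

Lemma sdiff_ext p q a d p' q' a' d' : sdiff p q a d ->
  p =1 p' -> q =1 q' -> a = a' -> d = d' -> sdiff p' q' a' d'.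
Proof. by move=> H /funext <- /funext <- <- <-. Qed.

Lemma sdiff_limr p q a d : sdiff p q a d -> ulim F q a.
Proof.
move=> [pa qpd]; rewrite -(addr0 a) -(mulr0 d).
apply: ulim_near (ulimD pa (ulimM qpd h_lim0)) _; near=> m.
rewrite divfK; last by near: m.
by rewrite addrC subrK.
Unshelve. all: by end_near. Qed.

Lemma sdiff_cst p a : ulim F p a -> sdiff p p a 0.
Proof.
by move=> pa; split=> //; apply: ulim_ext (ulim_cst 0) => m; rewrite subrr mul0r.
Qed.

Lemma sdiffD p q a d p' q' a' d' : sdiff p q a d -> sdiff p' q' a' d' ->
  sdiff (fun m => p m + p' m) (fun m => q m + q' m) (a + a') (d + d').
Proof.
move=> [pa qd] [pa' qd']; split; first exact: ulimD.
by apply: ulim_ext (ulimD qd qd') => m; rewrite -mulrDl opprD addrACA.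
Qed.

Lemma sdiffM p q a d p' q' a' d' : sdiff p q a d -> sdiff p' q' a' d' ->
  sdiff (fun m => p m * p' m) (fun m => q m * q' m) (a * a') (d * a' + a * d').
Proof.
move=> pq pq'; split; first by apply: ulimM; [exact: pq.1|exact: pq'.1].
apply: ulim_ext (ulimD (ulimM pq.2 (sdiff_limr pq')) (ulimM pq.1 pq'.2)) => m.
ring.
Qed.

Lemma sdiffN p q a d : sdiff p q a d -> sdiff (fun m => - p m) (fun m => - q m) (- a) (- d).
Proof.
move=> [pa qd]; split; first exact: ulimN.
by apply: ulim_ext (ulimN qd) => m; ring.
Qed.

Lemma sdiff_sum (I : Type) (r : seq I) (P : pred I) (p q : I -> nat -> K) (a d : I -> K) :
  (forall i, P i -> sdiff (p i) (q i) (a i) (d i)) ->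
  sdiff (fun m => \sum_(i <- r | P i) p i m) (fun m => \sum_(i <- r | P i) q i m)
    (\sum_(i <- r | P i) a i) (\sum_(i <- r | P i) d i).
Proof.
move=> H; split; first by apply: ulim_sum => i /H[].
apply: (@ulim_ext _ _ _ (fun m => \sum_(i <- r | P i) (q i m - p i m) / h m)) => [m|].
  by rewrite -mulr_suml sumrB.
by apply: ulim_sum => i /H[].
Qed.

(** The derivative is kept in logarithmic form [a * d]: powers multiply [d] by [n], with no exponent
    [n - 1], and products add the [d]. *)
Lemma sdiffX p q a d n : sdiff p q a (a * d) ->
  sdiff (fun m => p m ^+ n) (fun m => q m ^+ n) (a ^+ n) (a ^+ n * (n%:R * d)).
Proof.
move=> pq; elim: n => [|n IH].
  by rewrite mul0r mulr0; apply: sdiff_cst; apply: ulim_cst.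
apply: (sdiff_ext (sdiffM pq IH)) => [m|m||]; rewrite ?exprS // -natr1; ring.
Qed.

Lemma sdiff_prod (I : Type) (r : seq I) (p q : I -> nat -> K) (a d : I -> K) :
  (forall i, sdiff (p i) (q i) (a i) (a i * d i)) ->
  sdiff (fun m => \prod_(i <- r) p i m) (fun m => \prod_(i <- r) q i m)
    (\prod_(i <- r) a i) (\prod_(i <- r) a i * \sum_(i <- r) d i).
Proof.
move=> H; elim: r => [|i r IH].
  by apply: (sdiff_ext (sdiff_cst (ulim_cst 1))) => [m|m||]; rewrite !big_nil ?mulr0.
apply: (sdiff_ext (sdiffM (H i) IH)) => [m|m||]; rewrite !big_cons //; ring.
Qed.

End StrictDifferences.

(** * The ML system as a map and its differential *)

Section MLMap.
Variables (R : realType) (T : finType) (n k : nat).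
Variables (jj : T -> 'I_k) (b : T -> 'I_n -> nat).
Local Notation C := R[i].
Local Notation I := ('I_n + 'I_k)%type.
Implicit Types (c : T -> C) (u : 'I_n -> C) (z v : I -> C).

Definition ml_map c u z (l : I) : C := match l with
  | inl i => u i - \sum_a z (inr (jj a)) * (c a * monom b (z \o inl) a) * (b a i)%:R
  | inr j => \sum_(a | jj a == j) c a * monom b (z \o inl) a end.

(** The differential of [ml_map] in [z], written with the logarithmic increments [v / z]; it has
    this meaning only where every [z (inl i)] is nonzero. *)
Definition ml_diff c z v (l : I) : C :=
  let bxi a := \sum_i (b a i)%:R * (v (inl i) / z (inl i)) in
  match l with
  | inl i => - \sum_a (v (inr (jj a)) + z (inr (jj a)) * bxi a)
                    * (c a * monom b (z \o inl) a) * (b a i)%:R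
  | inr j => \sum_(a | jj a == j) c a * monom b (z \o inl) a * bxi a end.

Lemma ml_mapP c u z :
  (forall l, ml_map c u z l = 0) <-> ml_solution jj b c u (z \o inl) (z \o inr).
Proof.
split=> [E|[solu solf] [i|j]] /=; last exact: solf.
  split=> [i|j]; last exact: E (inr j).
  by apply/eqP; rewrite -subr_eq0; apply/eqP; exact: E (inl i).
by rewrite solu subrr.
Qed.

Lemma ml_diffP c z v : (forall l, ml_diff c z v l = 0) <->
  ml_kernel jj b c (z \o inl) (z \o inr) (fun i => v (inl i) / z (inl i)) (v \o inr).
Proof.
split=> [E|[kerf keru] [i|j]] /=; last exact: kerf.
  split=> [j|i]; first exact: E (inr j).
  by apply/eqP; rewrite -oppr_eq0; apply/eqP; exact: E (inl i).
by apply/eqP; rewrite oppr_eq0; apply/eqP; exact: keru.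
Qed.

Lemma ml_diff_linear c z s v v' l :
  ml_diff c z (fun l => s * v l + v' l) l = s * ml_diff c z v l + ml_diff c z v' l.
Proof.
have bxiE a : \sum_i (b a i)%:R * ((s * v (inl i) + v' (inl i)) / z (inl i)) =
    s * (\sum_i (b a i)%:R * (v (inl i) / z (inl i))) + \sum_i (b a i)%:R * (v' (inl i) / z (inl i)).
  by rewrite mulr_sumr -big_split; apply: eq_bigr => i _ /=; ring.
case: l => [i|j] /=; last first.
  by rewrite mulr_sumr -big_split; apply: eq_bigr => a _ /=; rewrite bxiE; ring.
rewrite mulrN -opprD; congr (- _).
by rewrite mulr_sumr -big_split; apply: eq_bigr => a _ /=; rewrite bxiE; ring.
Qed.

Lemma ml_diff_sum c z (J : Type) (r : seq J) (s : J -> C) (f : J -> I -> C) l :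
  ml_diff c z (fun l => \sum_(j <- r) s j * f j l) l = \sum_(j <- r) s j * ml_diff c z (f j) l.
Proof.
elim: r => [|j r IH].
  rewrite big_nil (_ : (fun _ => _) = (fun l' : I => -1 * 0 + 0)).
    by rewrite (ml_diff_linear c z (-1) (fun=> 0) (fun=> 0)) mulN1r addNr.
  by apply/funext => l'; rewrite big_nil mulr0 addr0.
rewrite big_cons -IH -ml_diff_linear; congr (ml_diff c z _ l).
by apply/funext => l'; rewrite big_cons.
Qed.

Lemma ml_diff_surjective c z : (forall v, (forall l, ml_diff c z v l = 0) -> forall l, v l = 0) ->
  forall w : I -> C, exists v, forall l, ml_diff c z v l = w l.
Proof.
move=> inj w; pose N := #|{: I}|.
pose fv (V : 'rV[C]_N) (l : I) : C := V 0 (enum_rank l).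
pose delta (l l' : I) : C := (l == l')%:R.
pose M : 'M[C]_N := \matrix_(l, l') ml_diff c z (delta (enum_val l)) (enum_val l').
have ME V l : (V *m M) 0 (enum_rank l) = ml_diff c z (fv V) l.
  have -> : fv V = fun l => \sum_(j < N) V 0 j * delta (enum_val j) l.
    apply/funext => l'; rewrite (bigD1 (enum_rank l')) //= /delta enum_rankK eqxx mulr1.
    rewrite big1 ?addr0 // => j /negbTE jl.
    by rewrite -[X in _ == X]enum_rankK (inj_eq enum_val_inj) jl mulr0.
  by rewrite ml_diff_sum mxE; apply: eq_bigr => j _; rewrite mxE enum_rankK.
have Mu : M \in unitmx.
  rewrite -row_free_unit -kermx_eq0; apply/negPn/negP => /rowV0Pn[V /sub_kermxP VM /rV0Pn[q]].
  apply/negP; rewrite negbK; apply/eqP; rewrite -[q]enum_valK; apply: (inj (fv V)) => l.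
  by rewrite -ME VM mxE.
exists (fv ((\row_q w (enum_val q)) *m invmx M)) => l.
by rewrite -ME mulmxKV // mxE enum_rankK.
Qed.

Variables (F : set_system nat).
Context {FU : UltraFilter F}.
Let FP : ProperFilter F := ultra_proper.
Local Existing Instance FP.

Variables (cm : nat -> T -> C) (um : nat -> 'I_n -> C) (c : T -> C) (u : 'I_n -> C).
Hypothesis cm_lim : forall a, ulim F (fun m => cm m a) (c a).
Hypothesis um_lim : forall i, ulim F (fun m => um m i) (u i).

Lemma ml_map_lim (z : nat -> I -> C) (z0 : I -> C) :
  (forall l, ulim F (fun m => z m l) (z0 l)) ->
  forall l, ulim F (fun m => ml_map (cm m) (um m) (z m) l) (ml_map c u z0 l).
Proof.
move=> zP; have monP a : ulim F (fun m => monom b (z m \o inl) a) (monom b (z0 \o inl) a).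
  by apply: ulim_prod => i _; apply: ulimX; exact: zP.
case=> [i|j] /=.
  apply: ulimB => //; apply: ulim_sum => a _; apply: ulimM; last exact: ulim_cst.
  by apply: ulimM => //; apply: ulimM.
by apply: ulim_sum => a _; apply: ulimM.
Qed.

(** Both values use the same coefficients [cm m] and data [um m], so the quotient retains only the
    variation in [z]. *)
Lemma ml_map_sdiff (z z' : nat -> I -> C) (z0 v0 : I -> C) (h : nat -> C) :
  (forall i, z0 (inl i) != 0) -> ulim F h 0 -> (\forall m \near F, h m != 0) ->
  (forall l, ulim F (fun m => z m l) (z0 l)) ->
  (forall l, ulim F (fun m => (z' m l - z m l) / h m) (v0 l)) ->
  forall l, ulim F (fun m => (ml_map (cm m) (um m) (z' m) l - ml_map (cm m) (um m) (z m) l) / h m)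
    (ml_diff c z0 v0 l).
Proof.
move=> x0 h0 hn0 zP zvP.
have zS l : sdiff F h (fun m => z m l) (fun m => z' m l) (z0 l) (v0 l) by [].
have monS a : sdiff F h (fun m => monom b (z m \o inl) a) (fun m => monom b (z' m \o inl) a)
    (monom b (z0 \o inl) a)
    (monom b (z0 \o inl) a * \sum_i (b a i)%:R * (v0 (inl i) / z0 (inl i))).
  apply: sdiff_prod => // i; apply: sdiffX => //.
  by rewrite mulrC divfK //; exact: zS.
have cmonS a : sdiff F h (fun m => cm m a * monom b (z m \o inl) a)
    (fun m => cm m a * monom b (z' m \o inl) a) (c a * monom b (z0 \o inl) a)
    (c a * monom b (z0 \o inl) a * \sum_i (b a i)%:R * (v0 (inl i) / z0 (inl i))).
  by apply: (sdiff_ext (sdiffM h0 hn0 (sdiff_cst h (cm_lim a)) (monS a))) => //; ring.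
case=> [i|j] /=; last first.
  suff [] : sdiff F h (fun m => \sum_(a | jj a == j) cm m a * monom b (z m \o inl) a)
    (fun m => \sum_(a | jj a == j) cm m a * monom b (z' m \o inl) a)
    (\sum_(a | jj a == j) c a * monom b (z0 \o inl) a) 
    (ml_diff c z0 v0 (inr j)) by [].
  by apply: sdiff_sum => a _; exact: cmonS.
suff [] : sdiff F h
  (fun m => um m i
    - \sum_a z m (inr (jj a)) * (cm m a * monom b (z m \o inl) a) * (b a i)%:R)
  (fun m => um m i
    - \sum_a z' m (inr (jj a)) * (cm m a * monom b (z' m \o inl) a) * (b a i)%:R)
  (ml_map c u z0 (inl i)) (ml_diff c z0 v0 (inl i)) by [].
rewrite -[ml_diff _ _ _ _]add0r; apply: sdiffD; first exact: sdiff_cst.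
apply: sdiffN; apply: sdiff_sum => a _.
apply: (sdiff_ext (sdiffM h0 hn0 (sdiffM h0 hn0 (zS (inr (jj a))) (cmonS a))
  (sdiff_cst h (ulim_cst (b a i)%:R)))) => //; ring.
Qed.

End MLMap.

(** * Existence and uniqueness of zeros near a nondegenerate zero *)

Section LocalSolutions.
Variables (R : realType) (F : set_system nat).
Context {FU : UltraFilter F}.
Let FP : ProperFilter F := ultra_proper.
Local Existing Instance FP.
Hypothesis F_cofinite : forall N, F [set m | (N <= m)%N].

Lemma ulim_harmonic : ulim F (fun m => real_complex R m.+1%:R^-1) 0.
Proof.
move=> e /posc_re[-> e0]; near=> m.
rewrite subr0 normc_real_complex ltcR ger0_norm ?invr_ge0 //.
rewrite invf_plt ?posrE //.
have : (Num.bound (complex.Re e)^-1 <= m)%N by near: m; exact: F_cofinite.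
move=> h; apply: (@lt_le_trans _ _ (Num.bound (complex.Re e)^-1)%:R).
  by apply: archi_boundP; rewrite invr_ge0 ltW.
by rewrite ler_nat leqW.
Unshelve. all: by end_near. Qed.

Lemma normc_ge0 (z : R[i]) : 0 <= Normc.normc z.
Proof. by case: z => x y; exact: sqrtr_ge0. Qed.

Lemma ulim_norm (z : nat -> R[i]) l : ulim F z l -> ulim F (fun m => `|z m|) `|l|.
Proof.
move=> zl e e0; near=> m; apply: le_lt_trans (ler_dist_dist _ _) _.
by near: m; exact: zl.
Unshelve. all: by end_near. Qed.

Variables (T : finType) (n k : nat) (jj : T -> 'I_k) (b : T -> 'I_n -> nat).
Local Notation C := R[i].
Local Notation I := ('I_n + 'I_k)%type.
Local Notation zeros c u := [set z | forall l, ml_map jj b c u z l = 0].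
Local Notation polydisc z0 delta := [set z : I -> C | forall l, `|z l - z0 l| <= delta].
Local Notation size_at c u z := (\sum_l Normc.normc (ml_map jj b c u z l)).

Lemma size_atE c u z : real_complex R (size_at c u z) = \sum_l `|ml_map jj b c u z l|.
Proof. by rewrite rmorph_sum. Qed.

(** Compactness by ultralimit: a minimizing sequence has bounded coordinates, and its limit attains
    the infimum by continuity. *)
Lemma polydisc_minimum c u z0 (delta : C) : 0 <= delta ->
  exists2 z, polydisc z0 delta z &
    forall z', polydisc z0 delta z' -> size_at c u z <= size_at c u z'.
Proof.
move=> delta0; pose A := [set size_at c u z | z in polydisc z0 delta].
have z0P : polydisc z0 delta z0 by move=> l; rewrite subrr normr0.
have infA : has_inf A.
  split; first by exists (size_at c u z0); exists z0.
  by exists 0 => _ [z _ <-]; apply: sumr_ge0 => l _; exact: normc_ge0.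
have /choice[z zP] (s : nat) : exists z, polydisc z0 delta z /\ size_at c u z < inf A + s.+1%:R^-1.
  have [|_ [z zP <-] zs] := @inf_adherent _ A (s.+1%:R^-1) _ infA; first by rewrite invr_gt0.
  by exists z.
have z_bounded l : ubounded F (fun s => z s l).
  exists (delta + `|z0 l|); apply: nearW => s; rewrite -[z s l](subrK (z0 l)).
  by apply: le_trans (ler_normD _ _) _; rewrite lerD2r; exact: (zP s).1.
have [z1 z1P] := choice (fun l => ulim_exists (z_bounded l)).
exists z1 => [l|z' z'P].
  apply: (ulim_norm_le (z := fun s => z s l - z0 l)); last by apply: nearW => s; exact: (zP s).1.
  by apply: ulimB => //; exact: ulim_cst.
apply/ler_addgt0Pr => e e0; rewrite -lecR size_atE.
rewrite -[leLHS]ger0_norm; last by apply: sumr_ge0.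
apply: (@ulim_norm_le _ _ _ (fun s => \sum_l `|ml_map jj b c u (z s) l|)).
  apply: ulim_sum => l _; apply: ulim_norm.
  by apply: (@ml_map_lim _ _ _ _ _ _ _ _ (fun=> c) (fun=> u)) => // *; exact: ulim_cst.
have := ulim_harmonic; move=> /(_ (real_complex R e)).
rewrite -[0]/(real_complex R 0) ltcR => /(_ e0) he; near=> s.
rewrite ger0_norm; last by apply: sumr_ge0.
rewrite -size_atE lecR; apply: le_trans (ltW (zP s).2) _; apply: lerD.
  by apply: (ge_inf infA.2); exists z'.
have : `|real_complex R s.+1%:R^-1 - 0| < real_complex R e by near: s.
by rewrite subr0 normc_real_complex ltcR ger0_norm ?invr_ge0 // => /ltW.
Unshelve. all: by end_near. Qed.

Variables (c : T -> C) (u : 'I_n -> C) (z0 : I -> C).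
Hypothesis z0_torus : forall i, z0 (inl i) != 0.
Hypothesis z0_zero : zeros c u z0.
Hypothesis z0_nondegenerate : forall v, (forall l, ml_diff jj b c z0 v l = 0) -> forall l, v l = 0.

(** The difference of two zeros, divided by its largest coordinate [h], would converge to a vector
    [v] with one coordinate equal to 1; both values of the map being 0, the differential at [z0]
    would kill [v]. *)
Lemma local_uniqueness cm um (z z' : nat -> I -> C) :
  (forall a, ulim F (fun m => cm m a) (c a)) -> (forall i, ulim F (fun m => um m i) (u i)) ->
  (forall l, ulim F (fun m => z m l) (z0 l)) -> (forall l, ulim F (fun m => z' m l) (z0 l)) ->
  (\forall m \near F, zeros (cm m) (um m) (z m)) ->
  (\forall m \near F, zeros (cm m) (um m) (z' m)) ->
  \forall m \near F, forall l, z m l = z' m l.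
Proof.
move=> cmP umP zP z'P zE z'E; apply: contrapT => /ultraP neq.
have [m1 /existsNP[l1 _]] := filter_ex neq.
pose f m := [arg max_(l > l1) Normc.normc (z' m l - z m l)]%O.
have [l0 l0P] := ultra_finite f.
have f_max : \forall m \near F, forall l, `|z' m l - z m l| <= `|z' m l0 - z m l0|.
  near=> m => l; have <- : f m = l0 by near: m.
  rewrite /f; case: arg_maxP => // l2 _ /(_ l isT).
  by rewrite -[_ <= _]/(real_complex R _ <= real_complex R _) lecR.
pose h m := z' m l0 - z m l0.
have h_neq0 : \forall m \near F, h m != 0.
  near=> m; have /existsNP[l zl] : ~ forall l, z m l = z' m l by near: m.
  have fm : forall l, `|z' m l - z m l| <= `|z' m l0 - z m l0| by near: m.
  have := fm l; rewrite -/(h m); apply: contraTneq => ->.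
  by rewrite normr0 normr_le0 subr_eq0; apply/eqP => H; exact: zl.
have h0 : ulim F h 0 by rewrite -(subrr (z0 l0)); apply: ulimB.
have v_bounded l : ubounded F (fun m => (z' m l - z m l) / h m).
  exists 1; near=> m; have hm : h m != 0 by near: m.
  have fm : forall l, `|z' m l - z m l| <= `|z' m l0 - z m l0| by near: m.
  by rewrite normrM normfV ler_pdivrMr ?normr_gt0 // mul1r.
have [v vP] := choice (fun l => ulim_exists (v_bounded l)).
have v0 : forall l, v l = 0.
  apply: z0_nondegenerate => l.
  apply: ulim_unique (ml_map_sdiff jj b cmP umP z0_torus h0 h_neq0 zP vP l) _.
  apply: ulim_near (ulim_cst 0) _; near=> m.
  have zm : zeros (cm m) (um m) (z m) by near: m.
  have z'm : zeros (cm m) (um m) (z' m) by near: m.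
  by rewrite zm z'm subrr mul0r.
have : v l0 = 1.
  apply: ulim_unique (vP l0) _; apply: ulim_near (ulim_cst 1) _; near=> m.
  by rewrite divff //; near: m.
by rewrite v0 => /eqP; rewrite eq_sym oner_eq0.
Unshelve. all: by end_near. Qed.

(** Otherwise zeros other than [z0] within [1 / s.+1] of it would contradict [local_uniqueness] for
    the constant system and the constant sequence [z0]. *)
Lemma isolated_zero : exists2 delta : C, 0 < delta &
  forall z, polydisc z0 delta z -> zeros c u z -> forall l, z l = z0 l.
Proof.
apply: contrapT => H.
have /choice[z zP] (s : nat) : exists z, [/\ polydisc z0 (real_complex R s.+1%:R^-1) z,
    zeros c u z & ~ forall l, z l = z0 l].
  apply: contrapT => Hs; apply: H; exists (real_complex R s.+1%:R^-1).
    by rewrite -[0]/(real_complex R 0) ltcR invr_gt0.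
  by move=> z zd zE; apply: contrapT => zz0; apply: Hs; exists z.
have zlim l : ulim F (fun s => z s l) (z0 l).
  move=> e e0; have He := ulim_harmonic e0; near=> s.
  have [zd _ _] := zP s; apply: le_lt_trans (zd l) _.
  have : `|real_complex R s.+1%:R^-1 - 0| < e by near: s.
  by rewrite subr0 normc_real_complex ger0_norm ?invr_ge0.
have : \forall s \near F, forall l, z s l = z0 l.
  apply: (@local_uniqueness (fun=> c) (fun=> u) z (fun=> z0)) => //.
  - by move=> a; exact: ulim_cst.
  - by move=> i; exact: ulim_cst.
  - by move=> l; exact: ulim_cst.
  - by apply: nearW => s; have [] := zP s.
  - by apply: nearW.
by move=> /filter_ex[s]; have [_ _] := zP s.
Unshelve. all: by end_near. Qed.

(* The minimum of the size of the system on a small polydisc tends to [z0]; a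
   Newton step from it would decrease the size if it were not a zero. *)
Lemma local_existence cm um :
  (forall a, ulim F (fun m => cm m a) (c a)) -> (forall i, ulim F (fun m => um m i) (u i)) ->
  exists2 z : nat -> I -> C, forall l, ulim F (fun m => z m l) (z0 l) &
    \forall m \near F, zeros (cm m) (um m) (z m).
Proof.
move=> cmP umP; have [delta delta0 isol] := isolated_zero.
have /choice[z zP] m : exists z, polydisc z0 delta z /\
    forall z', polydisc z0 delta z' -> size_at (cm m) (um m) z <= size_at (cm m) (um m) z'.
  by have [z z1 z2] := polydisc_minimum (cm m) (um m) z0 (ltW delta0); exists z.
have z_bounded l : ubounded F (fun s => z s l).
  exists (delta + `|z0 l|); apply: nearW => s; rewrite -[z s l](subrK (z0 l)).
  by apply: le_trans (ler_normD _ _) _; rewrite lerD2r; exact: (zP s).1.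
have [z1 z1P] := choice (fun l => ulim_exists (z_bounded l)).
have z1d : polydisc z0 delta z1.
  move=> l; apply: (ulim_norm_le (z := fun s => z s l - z0 l)).
    by apply: ulimB => //; exact: ulim_cst.
  by apply: nearW => s; exact: (zP s).1.
(* The minimum is at most the size at [z0], which tends to 0. So the limit [z1] of the minimizers is
   a zero, and isolation identifies it with [z0]. *)
have size0 : ulim F (fun m => real_complex R (size_at (cm m) (um m) (z m))) 0.
  have H : ulim F (fun m => real_complex R (size_at (cm m) (um m) z0)) 0.
    rewrite [X in ulim _ _ X](_ : 0 = \sum_(l : I) 0); last by rewrite big1.
    apply: (@ulim_ext _ _ _ (fun m => \sum_l `|ml_map jj b (cm m) (um m) z0 l|)).
      by move=> m; rewrite size_atE.
    apply: ulim_sum => l _.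
    rewrite [X in ulim _ _ X](_ : 0 = `|ml_map jj b c u z0 l|); last by rewrite z0_zero normr0.
    apply: ulim_norm.
    by apply: ml_map_lim => // l'; exact: ulim_cst.
  move=> e e0; near=> m.
  have : `|real_complex R (size_at (cm m) (um m) z0) - 0| < e by near: m; exact: H.
  have pos zz : 0 <= real_complex R (size_at (cm m) (um m) zz).
    by rewrite size_atE; apply: sumr_ge0.
  rewrite !subr0 !ger0_norm //; apply: le_lt_trans; rewrite lecR.
  by apply: (zP m).2 => l; rewrite subrr normr0 ltW.
have z1E : zeros c u z1.
  move=> l; apply: ulim_unique (ml_map_lim jj b cmP umP z1P l) _.
  move=> e e0; near=> m; rewrite subr0.
  have : `|real_complex R (size_at (cm m) (um m) (z m)) - 0| < e by near: m; exact: size0.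
  rewrite subr0 size_atE ger0_norm; last by apply: sumr_ge0.
  by apply: le_lt_trans; rewrite (bigD1 l) //= lerDl; apply: sumr_ge0.
have zlim l : ulim F (fun m => z m l) (z0 l) by rewrite -(isol z1 z1d z1E l).
exists z => //.
pose h m := real_complex R (size_at (cm m) (um m) (z m)).
have hE m : h m = \sum_l `|ml_map jj b (cm m) (um m) (z m) l| by rewrite /h size_atE.
have h_ge0 m : 0 <= h m by rewrite hE; apply: sumr_ge0.
have le_h m l : `|ml_map jj b (cm m) (um m) (z m) l| <= h m.
  by rewrite hE (bigD1 l) //= lerDl; apply: sumr_ge0.
have [h_eq0|/ultraP hN0] := pselect (\forall m \near F, h m = 0).
  apply: filterS h_eq0 => m hm l; apply/eqP; rewrite -normr_le0 -hm; exact: le_h.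
have h_neq0 : \forall m \near F, h m != 0 by apply: filterS hN0 => m /eqP.
have w_bounded l : ubounded F (fun m => ml_map jj b (cm m) (um m) (z m) l / h m).
  exists 1; near=> m; have hm : h m != 0 by near: m.
  by rewrite normrM normfV ler_pdivrMr ?normr_gt0 // mul1r [leRHS]ger0_norm.
have [w wP] := choice (fun l => ulim_exists (w_bounded l)).
(* Newton direction: the differential sends [v] to minus the limit [w] of the normalized values, so
   the step [h m * v] leaves a value of order [o(h m)], below the minimum [h m]. *)
have [v vE] := ml_diff_surjective z0_nondegenerate (fun l => - w l).
pose z' m l := z m l + h m * v l.
have h_lim0 : ulim F h 0 by [].
have z'v l : ulim F (fun m => (z' m l - z m l) / h m) (v l).
  apply: ulim_near (ulim_cst (v l)) _; near=> m.
  by rewrite /z' addrC addKr mulrC mulKf //; near: m.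
have newton l : ulim F (fun m => `|ml_map jj b (cm m) (um m) (z' m) l| / h m) 0.
  have H : ulim F (fun m => ml_map jj b (cm m) (um m) (z' m) l / h m) 0.
    rewrite -(addNr (w l)) -vE.
    apply: ulim_ext (ulimD (ml_map_sdiff jj b cmP umP z0_torus h_lim0 h_neq0 zlim z'v l) (wP l)) => m.
    by rewrite -mulrDl subrK.
  rewrite [X in ulim _ _ X](_ : 0 = `|0 : C|); last by rewrite normr0.
  apply: ulim_ext (ulim_norm H) => m.
  by rewrite normrM normfV (ger0_norm (h_ge0 m)).
have small : ulim F (fun m => real_complex R (size_at (cm m) (um m) (z' m)) / h m) 0.
  rewrite [X in ulim _ _ X](_ : 0 = \sum_(l : I) 0); last by rewrite big1.
  apply: (@ulim_ext _ _ _ (fun m => \sum_l `|ml_map jj b (cm m) (um m) (z' m) l| / h m)).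
    by move=> m; rewrite size_atE mulr_suml.
  by apply: ulim_sum => l _; exact: newton.
have z'lim l : ulim F (fun m => z' m l) (z0 l).
  rewrite -(addr0 (z0 l)) -(mul0r (v l)).
  by apply: ulimD => //; apply: ulimM => //; exact: ulim_cst.
have z'd : \forall m \near F, polydisc z0 delta (z' m).
  by apply: filter_forall => l; near=> m; apply: ltW; near: m; exact: z'lim.
have : \forall m \near F, False.
  near=> m; have hm : h m != 0 by near: m.
  have h_gt0 : 0 < h m by rewrite lt_neqAle eq_sym hm h_ge0.
  have z'dm : polydisc z0 delta (z' m) by near: m.
  have := (zP m).2 _ z'dm; rewrite -lecR -/(h m) => hz'.
  have : `|real_complex R (size_at (cm m) (um m) (z' m)) / h m - 0| < 1.
    by near: m; apply: small.
  rewrite subr0 ger0_norm; last by rewrite divr_ge0 // (le_trans (h_ge0 m)).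
  by rewrite ltr_pdivrMr // mul1r => /(le_lt_trans hz'); rewrite ltxx.
by move=> /filter_ex[].
Unshelve. all: by end_near. Qed.

End LocalSolutions.

(** If [x i = 0], every term of the equation for [u i] vanishes: either [b a i = 0] or [x i] divides
    the monomial. *)
Lemma ml_solution_torus (C : numFieldType) (T : finType) (n k : nat)
    (jj : T -> 'I_k) (b : T -> 'I_n -> nat) c u x lam :
  ml_solution (C := C) jj b c u x lam -> forall i, u i != 0 -> x i != 0.
Proof.
move=> [solu _] i; apply: contraNneq => xi; rewrite solu big1 // => a _.
have [-> | bi] := eqVneq (b a i) 0%N; first by rewrite mulr0.
by rewrite /monom (bigD1 i) //= xi expr0n (negbTE bi) mul0r !(mulr0, mul0r).
Qed.

(** * Local constancy of the number of solutions *)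

Section StableCount.
Variables (R : realType) (F : set_system nat).
Context {FU : UltraFilter F}.
Let FP : ProperFilter F := ultra_proper.
Local Existing Instance FP.
Hypothesis F_cofinite : forall N, F [set m | (N <= m)%N].
Variables (T T0 : finType) (n k : nat) (jj : T -> 'I_k) (b : T -> 'I_n -> nat).
Variable iota : T0 -> T.
Hypothesis iota_inj : injective iota.
Hypothesis iota_onto : forall j, exists a, jj (iota a) = j.
Hypothesis in_hull : forall a : T, exists (m : nat) (w : 'I_m -> R) (e : 'I_m -> T0),
  [/\ forall s, 0 <= w s, \sum_s w s = 1, forall s, jj (iota (e s)) = jj a
    & forall i, (b a i)%:R = \sum_s w s * (b (iota (e s)) i)%:R].

Local Notation C := R[i].
Local Notation I := ('I_n + 'I_k)%type.
Local Notation Z := ({ffun 'I_n -> C} * {ffun 'I_k -> C})%type.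

Definition ml_set (c : T -> C) (u : 'I_n -> C) : set Z :=
  [set xl : Z | ml_solution jj b c u xl.1 xl.2].

Definition coords (xl : Z) (l : I) : C := match l with inl i => xl.1 i | inr j => xl.2 j end.
Definition of_coords (z : I -> C) : Z := ([ffun i => z (inl i)], [ffun j => z (inr j)]).

Lemma of_coordsK z l : coords (of_coords z) l = z l.
Proof. by case: l => [i|j] /=; rewrite ffunE. Qed.

Lemma coords_inj xl xl' : (forall l, coords xl l = coords xl' l) -> xl = xl'.
Proof.
move: xl xl' => [x l] [x' l'] H; congr (_, _); apply/ffunP => i.
  exact: (H (inl i)).
exact: (H (inr i)).
Qed.

Lemma ml_setP c u xl : ml_set c u xl <-> forall l, ml_map jj b c u (coords xl) l = 0.
Proof. by split=> [|/(ml_mapP jj b c u)] => [H|//]; apply/ml_mapP. Qed.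

Lemma ml_set_of_coords c u z :
  (forall l, ml_map jj b c u z l = 0) <-> ml_set c u (of_coords z).
Proof.
rewrite ml_setP; suff -> : coords (of_coords z) = z by [].
by apply/funext => l; rewrite of_coordsK.
Qed.

Variables (c : T -> C) (u : 'I_n -> C).
Hypothesis c_off : forall a, a \notin codom iota -> c a = 0.
Hypothesis generic :
  ml_generic (fun a => jj (iota a)) (fun a => b (iota a)) (fun a => c (iota a)) u.

Lemma ml_solution_codom x lam : ml_solution jj b c u x lam <->
  ml_solution (fun a => jj (iota a)) (fun a => b (iota a)) (fun a => c (iota a)) u x lam.
Proof.
have Eu i : \sum_a lam (jj a) * (c a * monom b x a) * (b a i)%:R =
    \sum_a lam (jj (iota a)) * (c (iota a) * monom b x (iota a)) * (b (iota a) i)%:R.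
  by apply: (sum_codom iota_inj xpredT) => a /c_off ->; rewrite mul0r mulr0 mul0r.
have Ef j : \sum_(a | jj a == j) c a * monom b x a =
    \sum_(a | jj (iota a) == j) c (iota a) * monom b x (iota a).
  by apply: (sum_codom iota_inj (fun a => jj a == j)) => a /c_off ->; rewrite mul0r.
by split=> -[solu solf]; split=> [i|j]; rewrite ?solu ?Eu // -?Ef ?solf ?Ef.
Qed.

Lemma ml_kernel_codom x lam xi mu : ml_kernel jj b c x lam xi mu ->
  ml_kernel (fun a => jj (iota a)) (fun a => b (iota a)) (fun a => c (iota a)) x lam xi mu.
Proof.
move=> [kerf keru]; split=> [j|i].
  rewrite -[RHS](kerf j); apply/esym.
  by apply: (sum_codom iota_inj (fun a => jj a == j)) => a /c_off ->; rewrite !mul0r.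
rewrite -[RHS](keru i); apply/esym.
by apply: (sum_codom iota_inj xpredT) => a /c_off ->; rewrite mul0r mulr0 mul0r.
Qed.

Lemma ml_set_torus xl : ml_set c u xl -> forall i, xl.1 i != 0.
Proof. by case: generic => u0 _ _ _ /ml_solution_torus H i; exact: H. Qed.

Lemma ml_set_nondegenerate xl : ml_set c u xl ->
  forall v, (forall l, ml_diff jj b c (coords xl) v l = 0) -> forall l, v l = 0.
Proof.
move=> xlS v /ml_diffP /ml_kernel_codom ker; case: generic => _ _ _ nd.
have x0 := ml_set_torus xlS.
have [|xi0 mu0] := nd xl.1 xl.2 x0 _ _ _ ker; first by apply/ml_solution_codom.
case=> [i|j]; last exact: mu0.
by move/eqP: (xi0 i); rewrite /= mulf_eq0 invr_eq0 (negbTE (x0 i)) orbF => /eqP.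
Qed.

Section Perturbation.
Variables (cm : nat -> T -> C) (um : nat -> 'I_n -> C).
Hypothesis cm_lim : forall a, ulim F (fun m => cm m a) (c a).
Hypothesis um_lim : forall i, ulim F (fun m => um m i) (u i).

Lemma ml_set_limit (s : nat -> Z) : (\forall m \near F, ml_set (cm m) (um m) (s m)) ->
  exists2 s0, ml_set c u s0 & forall l, ulim F (fun m => coords (s m) l) (coords s0 l).
Proof.
move=> sE; case: generic => u0 cg ug _.
have x0 : \forall m \near F, forall i, (s m).1 i != 0.
  have um0 : \forall m \near F, forall i, um m i != 0.
    by apply: filter_forall => i; apply: ulim_neq0 (um_lim i) (u0 i).
  near=> m => i; have sm : ml_set (cm m) (um m) (s m) by near: m.
  have um0' : forall i, um m i != 0 by near: m.
  exact: ml_solution_torus sm i (um0' i).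
have [x [lam [_ xP lamP]]] := ml_solutions_proper iota_inj iota_onto in_hull c_off cg ug
  (x := fun m i => (s m).1 i) (lam := fun m j => (s m).2 j) cm_lim um_lim x0 sE.
pose z (l : I) := match l with inl i => x i | inr j => lam j end.
have zP l : ulim F (fun m => coords (s m) l) (z l).
  by case: l => [i|j]; [exact: xP|exact: lamP].
exists (of_coords z); last by move=> l; rewrite of_coordsK.
apply/ml_set_of_coords => l; apply: ulim_unique (ml_map_lim jj b cm_lim um_lim zP l) _.
apply: ulim_near (ulim_cst 0) _; near=> m.
have sm : ml_set (cm m) (um m) (s m) by near: m.
by have /ml_setP := sm.
Unshelve. all: by end_near. Qed.

Lemma ml_set_unique s0 (s s' : nat -> Z) : ml_set c u s0 ->
  (forall l, ulim F (fun m => coords (s m) l) (coords s0 l)) ->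
  (forall l, ulim F (fun m => coords (s' m) l) (coords s0 l)) ->
  (\forall m \near F, ml_set (cm m) (um m) (s m)) ->
  (\forall m \near F, ml_set (cm m) (um m) (s' m)) ->
  \forall m \near F, s m = s' m.
Proof.
move=> s0S sP s'P sE s'E.
have zE (r : nat -> Z) : (\forall m \near F, ml_set (cm m) (um m) (r m)) ->
    \forall m \near F, forall l, ml_map jj b (cm m) (um m) (coords (r m)) l = 0.
  by apply: filterS => m /ml_setP.
apply: filterS (local_uniqueness (ml_set_torus s0S) (ml_set_nondegenerate s0S)
  cm_lim um_lim sP s'P (zE _ sE) (zE _ s'E)) => m H.
exact: coords_inj.
Qed.

Lemma ml_set_exists s0 : ml_set c u s0 ->
  exists s : nat -> Z, (forall l, ulim F (fun m => coords (s m) l) (coords s0 l)) /\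
    \forall m \near F, ml_set (cm m) (um m) (s m).
Proof.
move=> s0S; have /ml_setP s0E := s0S.
have [z zP zE] := local_existence F_cofinite (ml_set_torus s0S) s0E (ml_set_nondegenerate s0S)
  cm_lim um_lim.
exists (fun m => of_coords (z m)); split=> [l|].
  by apply: ulim_ext (zP l) => m; rewrite of_coordsK.
by apply: filterS zE => m /ml_set_of_coords.
Qed.

End Perturbation.

(** An infinite set would contain an injective sequence of solutions. Its limit [s0] is a solution
    by properness, and local uniqueness makes the sequence equal to [s0] along [F], hence at two
    distinct indices. *)
Lemma ml_set_finite : finite_set (ml_set c u).
Proof.
apply: contrapT => /infiniteP/card_leP[f].
pose s m : Z := val (f (SigSub (mem_setT m))).
have sS m : ml_set c u (s m) by apply: set_mem; exact: valP.
have s_inj m m' : s m = s m' -> m = m'.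
  move=> /val_inj H; have := 'inj_f (mem_setT _) (mem_setT _) H.
  by case.
have cl a : ulim F (fun=> c a) (c a) by exact: ulim_cst.
have ul i : ulim F (fun=> u i) (u i) by exact: ulim_cst.
have [|s0 s0S s0P] := @ml_set_limit (fun=> c) (fun=> u) cl ul s; first exact: nearW.
have H : \forall m \near F, s m = s0.
  apply: (@ml_set_unique (fun=> c) (fun=> u) cl ul s0) => //.
  - by move=> l; exact: ulim_cst.
  - exact: nearW.
  - exact: nearW.
have [m sm] := filter_ex H.
have [m' [sm' mm']] : exists m', s m' = s0 /\ (m < m')%N.
  by apply: (@filter_ex _ F); near=> m'; split; near: m'; [exact: H|exact: F_cofinite].
by move: mm'; rewrite (s_inj m m') ?ltnn // sm sm'.
Unshelve. all: by end_near. Qed.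

(** Continuing each solution [s0] to [phi s0] gives a bijection along [F]. Distinct limits give
    injectivity; a sequence of missed solutions would converge to some [s0] and coincide with
    [phi s0] by local uniqueness. *)
Theorem ml_set_card_stable (cm : nat -> T -> C) (um : nat -> 'I_n -> C) :
  (forall a, ulim F (fun m => cm m a) (c a)) -> (forall i, ulim F (fun m => um m i) (u i)) ->
  \forall m \near F, (ml_set (cm m) (um m) #= ml_set c u)%card.
Proof.
move=> cmP umP.
have [X XE] : exists X : {fset Z}, ml_set c u = [set` X].
  exact/finite_fsetP/ml_set_finite.
have /choice[phi phiP] (s0 : Z) : exists s : nat -> Z, ml_set c u s0 ->
    (forall l, ulim F (fun m => coords (s m) l) (coords s0 l)) /\
    \forall m \near F, ml_set (cm m) (um m) (s m).
  have [s0S|s0S] := pselect (ml_set c u s0); last by exists (fun=> s0).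
  by have [s sP] := ml_set_exists cmP umP s0S; exists s.
have near_all (P : Z -> set nat) : (forall s0, ml_set c u s0 -> \forall m \near F, P s0 m) ->
    \forall m \near F, forall s0, ml_set c u s0 -> P s0 m.
  move=> H; have := @filter_bigI _ _ X P F _; move=> /(_ _) HX.
  apply: filterS (HX _) => [m Hm s0|s0 s0X].
    by rewrite XE => s0X; exact: Hm.
  by apply: H; rewrite XE.
have phi_in : \forall m \near F, forall s0, ml_set c u s0 -> ml_set (cm m) (um m) (phi s0 m).
  by apply: near_all => s0 /phiP[].
have phi_inj : \forall m \near F, forall s0, ml_set c u s0 -> forall s1, ml_set c u s1 ->
    phi s0 m = phi s1 m -> s0 = s1.
  apply: (near_all (fun s0 m => forall s1, ml_set c u s1 -> phi s0 m = phi s1 m -> s0 = s1)) => s0 s0S.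
  apply: (near_all (fun s1 m => phi s0 m = phi s1 m -> s0 = s1)) => s1 s1S.
  apply: contrapT => /ultraP H; have [m0 Hm0] := filter_ex H; case: Hm0 => _.
  apply: coords_inj => l; have [P0 _] := phiP _ s0S; have [P1 _] := phiP _ s1S.
  apply: ulim_unique (P0 l) _; apply: ulim_near (P1 l) _; near=> m.
  have : ~ (phi s0 m = phi s1 m -> s0 = s1) by near: m.
  by move=> /not_implyP[-> _].
have phi_surj : \forall m \near F, forall s, ml_set (cm m) (um m) s ->
    exists2 s0, ml_set c u s0 & phi s0 m = s.
  apply: contrapT => /ultraP H.
  have /choice[s sP] m : exists s, ~ (forall s, ml_set (cm m) (um m) s ->
      exists2 s0, ml_set c u s0 & phi s0 m = s) ->
      ml_set (cm m) (um m) s /\ ~ exists2 s0, ml_set c u s0 & phi s0 m = s.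
    have [Hm|Hm] := pselect (forall s, ml_set (cm m) (um m) s ->
      exists2 s0, ml_set c u s0 & phi s0 m = s); first by exists (of_coords (fun=> 0)).
    by have /existsNP[s /not_implyP[s1 s2]] := Hm; exists s.
  have sE : \forall m \near F, ml_set (cm m) (um m) (s m) /\
      ~ exists2 s0, ml_set c u s0 & phi s0 m = s m by apply: filterS H => m /sP.
  have sE1 : \forall m \near F, ml_set (cm m) (um m) (s m) by apply: filterS sE => m [].
  have [s0 s0S s0P] := ml_set_limit cmP umP sE1.
  have [P0 E0] := phiP _ s0S.
  have U : \forall m \near F, s m = phi s0 m by exact: (ml_set_unique cmP umP s0S).
  have : \forall m \near F, False.
    near=> m; have [_ []] : ml_set (cm m) (um m) (s m) /\
      ~ exists2 s0, ml_set c u s0 & phi s0 m = s m by near: m.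
    by exists s0 => //; apply/esym; near: m.
  by move=> /filter_ex[].
near=> m; apply: card_esym.
have bij_phi : set_bij (ml_set c u) (ml_set (cm m) (um m)) (fun s0 => phi s0 m).
  split.
  - by move=> s0 s0S; move: s0 s0S; near: m.
  - have H : forall s0, ml_set c u s0 -> forall s1, ml_set c u s1 ->
      phi s0 m = phi s1 m -> s0 = s1 by near: m.
    by move=> s0 s1 /set_mem s0S /set_mem s1S; exact: H.
  - have H : forall s, ml_set (cm m) (um m) s ->
      exists2 s0, ml_set c u s0 & phi s0 m = s by near: m.
    by move=> s sS /=; have [s0 s0S <-] := H _ sS; exists s0.
exact: (pcard_eq (bij_phi : {bij _ >-> _})).
Unshelve. all: by end_near. Qed.

End StableCount.

(** * Generic points and deformation *)

Section NonVanishing.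
Variable C : numFieldType.

Lemma horner_mmap (n : nat) (f : 'I_n -> {poly C}) (h : {mpoly C[n]}) (t : C) :
  (mmap polyC f h).[t] = h.@[fun i => (f i).[t]].
Proof.
rewrite mevalE horner_sum; apply: eq_bigr => m _.
rewrite hornerM hornerC horner_prod; congr (_ * _).
by apply: eq_bigr => i _; rewrite horner_exp.
Qed.

Lemma poly_nonroot (q : {poly C}) : q != 0 -> exists t, q.[t] != 0.
Proof.
move=> q0; apply: contrapT => /forallNP H.
have rootq t : root q t by apply/negPn/negP => /H.
pose rs : seq C := [seq i%:R | i <- iota 0 (size q)].
have rs_uniq : uniq rs.
  by rewrite map_inj_uniq ?iota_uniq // => i j /eqP; rewrite eqr_nat => /eqP.
have rs_root : all (root q) rs by apply/allP => x _; exact: rootq.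
by have := max_poly_roots q0 rs_root rs_uniq; rewrite size_map size_iota ltnn.
Qed.

Lemma mpoly_nonvanishing (n : nat) (h : {mpoly C[n]}) : h != 0 -> exists p, h.@[p] != 0.
Proof.
elim: n h => [|n IH] h h0.
  have m0 (m' : 'X_{1..0}) : m' = 0%MM by apply/mnmP => -[].
  have hC : h = (h@_0%MM)%:MP.
    by apply/mpolyP => m; rewrite mcoeffC (m0 m) eqxx mulr1.
  exists (fun=> 0); rewrite hC mevalC; apply: contraNneq h0 => h00.
  by rewrite hC h00 mpolyC0.
pose r (m : 'X_{1..n.+1}) := [multinom m (widen_ord (leqnSn n) i) | i < n].
have r_inj (m m' : 'X_{1..n.+1}) : m ord_max = m' ord_max -> r m = r m' -> m = m'.
  move=> mm /mnmP rr; apply/mnmP => i; case: (unliftP ord_max i) => [j|] -> //.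
  by have := rr j; rewrite !mnmE lift_ord_max.
(* Any power of the last variable occurring in [h] serves, and [mlead] provides one; its coefficient
   [hd] is nonzero because it contains the monomial [r m0]. *)
pose m0 := mlead h; pose d := m0 ord_max.
pose hd : {mpoly C[n]} := \sum_(m <- msupp h | m ord_max == d) h@_m *: 'X_[r m].
have hd0 : hd != 0.
  apply: contraTneq (mlead_supp h0) => hd0; rewrite mcoeff_msupp negbK -/m0.
  have H := congr1 (mcoeff (r m0)) hd0; rewrite mcoeff0 in H.
  apply/eqP; rewrite -[RHS]H /hd big_mkcond raddf_sum.
  rewrite (bigD1_seq m0) ?msupp_uniq ?mlead_supp //= eqxx mcoeffZ mcoeffX eqxx mulr1.
  rewrite big1 ?addr0 // => m mm; case: eqP => [md|_]; last by rewrite mcoeff0.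
  rewrite mcoeffZ mcoeffX; case: eqP => [rm|_]; last by rewrite mulr0.
  by rewrite (r_inj m m0) ?eqxx in mm.
have [p hp] := IH _ hd0.
pose f (i : 'I_n.+1) : {poly C} := if unlift ord_max i is Some j then (p j)%:P else 'X.
have [|t ht] := @poly_nonroot (mmap polyC f h).
  apply: contra_neq hp => fh0; have := congr1 (fun q : {poly C} => q`_d) fh0.
  rewrite coef0 coef_sum => <-; rewrite /hd raddf_sum /= big_mkcond.
  apply: eq_bigr => m _; rewrite coefCM.
  have -> : mmap1 f m = (\prod_i p i ^+ m (widen_ord (leqnSn n) i))%:P * 'X^(m ord_max).
    rewrite /mmap1 big_ord_recr /= /f unlift_none rmorph_prod; congr (_ * _).
    by apply: eq_bigr => i _; rewrite -lift_ord_max liftK rmorphXn.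
  rewrite coefCM coefXn eq_sym; case: eqP => [md|_]; last by rewrite !mulr0.
  rewrite mulr1 mevalZ mevalX; congr (_ * _).
  by apply: eq_bigr => i _; rewrite mnmE.
by exists (fun i => (f i).[t]); rewrite -horner_mmap.
Qed.

End NonVanishing.

Lemma ulim_meval (K : numFieldType) (F : set_system nat) (FU : UltraFilter F)
    (n : nat) (h : {mpoly K[n]}) (p : nat -> 'I_n -> K) (p0 : 'I_n -> K) :
  (forall i, ulim F (fun m => p m i) (p0 i)) -> ulim F (fun m => h.@[p m]) h.@[p0].
Proof.
move=> pP; rewrite mevalE.
apply: (@ulim_ext _ _ _ (fun m => \sum_(e <- msupp h) h@_e * \prod_i p m i ^+ e i)).
  by move=> m; rewrite mevalE.
apply: ulim_sum => e _; apply: ulimM; first exact: ulim_cst.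
by apply: ulim_prod => i _; apply: ulimX.
Qed.

(** * One nonzero polynomial implying all genericity conditions *)

Section GenericPolynomial.
Variables (R : realType) (T : finType) (n k : nat).
Variables (jj : T -> 'I_k) (b : T -> 'I_n -> nat).
Local Notation C := R[i].
Local Notation V := (T + 'I_n)%type.
Local Notation at_ p h := (h.@[fun l => p (enum_val l)]).

Lemma generic_faces_polynomial : exists2 h : {mpoly C[#|{: V}|]}, h != 0 &
  forall p : V -> C, at_ p h != 0 -> faces_generic jj b (fun a => p (inl a)).
Proof.
(* One torus coordinate is added per polynomial, with exponent 1 on its terms. It carries [kappa],
   and its weighted condition is the vanishing of the sum of [d] within that polynomial. *)
pose bV (v : V) (w : 'I_k + 'I_n) : nat := match v, w with
  | inl a, inl j => (jj a == j) | inl a, inr i => b a i | inr _, _ => 0%N end.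
have /choice[h hP] (S : {set T}) : exists h : {mpoly C[#|{: V}|]}, h != 0 /\
    forall s0, s0 \in S -> forall (c d : V -> C) (z : 'I_k + 'I_n -> C),
    (forall a, a \in S -> c (inl a) = d (inl a) * \prod_i z i ^+ bV (inl a) i) ->
    \sum_(a in S) d (inl a) = 0 ->
    (forall i, \sum_(a in S) d (inl a) * (bV (inl a) i)%:R = 0) -> at_ c h = 0.
  have [[s0 s0S]|noS] := pselect (exists s0, s0 \in S); last first.
    exists 1; rewrite oner_eq0; split=> // s0 s0S; case: noS; by exists s0.
  have [|h h0 hP] := @torus_family_in_hypersurface C V _ (inl @: S) bV (inl s0).
    by apply/imsetP; exists s0.
  have inl_inj : {in S &, injective (@inl T 'I_n)} by move=> a a' _ _ [].
  exists h; split=> // _ _ c d z cE dE dbE; apply: (hP c d z).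
  - by move=> _ /imsetP[a aS ->]; exact: cE.
  - by rewrite big_imset.
  - by move=> i; rewrite big_imset.
exists (\prod_S h S); first by apply/prodf_neq0 => S _; exact: (hP S).1.
move=> p; rewrite rmorph_prod => /prodf_neq0 hp.
move=> F FU S s0 s0S cm d kappa x cmP cmE dj db.
have := hp S isT; apply/negP; rewrite negbK; apply/eqP.
(* The hypersurface is closed: [h S] vanishes at each approximating point, hence at the limit
   [p]. *)
pose pm m (v : V) := match v with inl a => cm m a | inr i => p (inr i) end.
have pmP : ulim F (fun m => at_ (pm m) (h S)) (at_ p (h S)).
  apply: ulim_meval => l; case: (enum_val l) => [a|i] /=; first exact: cmP.
  exact: ulim_cst.
apply: ulim_unique pmP _; apply: ulim_ext (ulim_cst 0) => m; apply/esym.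
pose dV (v : V) := match v with inl a => d a | inr i => 0 end.
pose z (w : 'I_k + 'I_n) := match w with inl j => kappa m j | inr i => x m i end.
apply: ((hP S).2 s0 s0S (pm m) dV z) => [a aS||i] /=.
- rewrite cmE // big_sumType /=; congr (_ * (_ * _)).
  rewrite (bigD1 (jj a)) //= eqxx expr1 big1 ?mulr1 // => j.
  by rewrite eq_sym => /negbTE ->; rewrite expr0.
- rewrite (partition_big jj xpredT) //= big1 // => j _; exact: dj.
case: i => [j|i] /=; last exact: db.
rewrite -[RHS](dj j) [RHS]big_mkcondr; apply: eq_bigr => a _ /=.
by case: eqP => _; rewrite ?mulr1 ?mulr0.
Qed.

Lemma generic_data_polynomial : exists2 h : {mpoly C[#|{: V}|]}, h != 0 &
  forall p : V -> C, at_ p h != 0 -> data_generic jj b (fun i => p (inr i)).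
Proof.
pose L (w : 'I_n -> R) : {mpoly C[#|{: V}|]} :=
  \sum_i real_complex R (w i) *: 'X_(enum_rank (inr i : V)).
have LE w p : at_ p (L w) = \sum_i real_complex R (w i) * p (inr i).
  by rewrite raddf_sum; apply: eq_bigr => i _; rewrite /= mevalZ mevalXU enum_rankK.
have /choice[h hP] (S : {set T}) : exists h : {mpoly C[#|{: V}|]}, h != 0 /\
    ((exists w : 'I_n -> R, orthogonal_to_faces jj b S w /\ exists i, w i != 0) ->
     exists2 w : 'I_n -> R, orthogonal_to_faces jj b S w & h = L w).
  have [[w [wS [i wi]]]|noS] := pselect (exists w : 'I_n -> R,
    orthogonal_to_faces jj b S w /\ exists i, w i != 0); last first.
    by exists 1; rewrite oner_eq0; split=> // /noS.
  exists (L w); split; last by move=> _; exists w.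
  apply: contraNneq wi => Lw.
  have := LE w (fun v => (v == inr i)%:R); rewrite Lw meval0 (bigD1 i) //= eqxx mulr1.
  rewrite big1 ?addr0 => [/esym/eqP|j ji].
    by rewrite -[0]/(real_complex R 0) (inj_eq (@complexI R)).
  by rewrite (inj_eq (@inr_inj _ _)) (negbTE ji) mulr0.
exists (\prod_S h S); first by apply/prodf_neq0 => S _; exact: (hP S).1.
move=> p; rewrite rmorph_prod => /prodf_neq0 hp S /(hP S).2[w wS hE].
by exists w => //; rewrite -LE -hE; exact: hp.
Qed.

Theorem generic_polynomial : (forall j, exists a, jj a = j) ->
  exists2 h : {mpoly C[#|{: V}|]}, h != 0 & forall p : V -> C, at_ p h != 0 ->
    (forall v, p v != 0) /\ ml_generic jj b (fun a => p (inl a)) (fun i => p (inr i)).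
Proof.
move=> /choice[pick pickK].
have [h1 h10 h1P] := generic_faces_polynomial.
have [h2 h20 h2P] := generic_data_polynomial.
have [h3 h30 h3P] := @generic_nondegenerate C T n k jj b pick pickK.
(* The product of the variables makes all coefficients and data nonzero; the monomials that appear
   are then exactly those of the support. *)
exists ((\prod_(v : V) 'X_(enum_rank v)) * h1 * h2 * h3).
  rewrite !mulf_neq0 //; apply/prodf_neq0 => v _.
  by rewrite -msize_poly_eq0 msizeX.
move=> p; rewrite !mevalM !mulf_eq0 !negb_or => /andP[/andP[/andP[X0 p1] p2] p3].
have p0 v : p v != 0.
  move: X0; rewrite rmorph_prod => /prodf_neq0 /(_ v isT).
  by rewrite /= mevalXU enum_rankK.
split=> //; split; [by move=> i; exact: p0|exact: h1P|exact: h2P|].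
by move=> x lam x0 sol xi mu ker; exact: (h3P p p3 x lam x0 sol xi mu ker).
Qed.

End GenericPolynomial.

(** Connectedness of the interval: the supremum of the initial segments on which [P] holds can be
    neither missed by [P] nor less than 1. *)
Lemma unit_interval_connected (R : realType) (P : R -> Prop) :
  (forall s, 0 <= s <= 1 -> exists2 e, 0 < e &
     forall s', 0 <= s' <= 1 -> `|s' - s| < e -> (P s' <-> P s)) ->
  P 0 -> P 1.
Proof.
move=> loc P0; pose A := [set s : R | 0 <= s <= 1 /\ forall s', 0 <= s' <= s -> P s'].
have A0 : A 0.
  split; first by rewrite lexx ler01.
  by move=> s'; rewrite -eq_le => /eqP <-.
have supA : has_sup A by split; [exists 0|exists 1 => s [/andP[]]].
pose sg := sup A.
have sg0 : 0 <= sg by exact: sup_upper_bound supA _ A0.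
have sg1 : sg <= 1 by apply: ge_sup; [exists 0|move=> s [/andP[]]].
have [|e e0 eP] := loc sg; first by rewrite sg0.
have [s1 [/andP[s10 s11] s1P] s1e] := sup_adherent e0 supA.
have s1sg : s1 <= sg by apply: sup_upper_bound supA _ _; split; rewrite ?s10.
have Psg : P sg.
  apply/(eP s1); [by rewrite s10| |by apply: s1P; rewrite s10 lexx].
  by rewrite distrC ger0_norm ?subr_ge0 // ltrBlDr -ltrBlDl.
have near_sg s : 0 <= s <= 1 -> s < sg + e -> P s.
  move=> /andP[h0 h1] he; have [ss1|s1s] := leP s s1; first by apply: s1P; rewrite h0.
  apply/(eP s); rewrite ?h0 // ltr_distl.
  by rewrite he (lt_trans s1e).
have [sg_lt1|sg_ge1] := ltP sg 1; last first.
  by apply: near_sg; rewrite ?ler01 ?lexx // (le_lt_trans sg_ge1) // ltrDl.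
pose s2 := Num.min 1 (sg + e / 2).
have s2sg : sg < s2 by rewrite lt_min sg_lt1 ltrDl divr_gt0.
have s2A : A s2.
  split; first by rewrite (le_trans sg0) ?(ltW s2sg) // ge_min lexx.
  move=> s' /andP[h0 h1]; apply: near_sg.
    by rewrite h0 (le_trans h1) // ge_min lexx.
  apply: le_lt_trans h1 _; rewrite gt_min ltrD2l ltr_pdivrMr // mulr_natr mulr2n ltrDl e0.
  by rewrite orbT.
by have := sup_upper_bound supA s2A; rewrite leNgt s2sg.
Qed.

(** * Deformation along a path of coefficients and data *)

Section Deformation.
Variables (R : realType) (T : finType) (n k : nat).
Variables (jj : T -> 'I_k) (b : T -> 'I_n -> nat).
Local Notation C := R[i].
Local Notation V := (T + 'I_n)%type.
Local Notation at_ p h := (h.@[fun l => p (enum_val l)]).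

Definition ml_set_at (p : V -> C) :=
  ml_set jj b (fun a => p (inl a)) (fun i => p (inr i)).

(* The monomials outside the image of [iota] have coefficient 0 at [p] but may
   appear in the systems near [p]. *)
Definition generic_on (T0 : finType) (iota : T0 -> T) (p : V -> C) : Prop :=
  [/\ injective iota, forall j, exists a, jj (iota a) = j,
      forall a : T, exists (m : nat) (w : 'I_m -> R) (e : 'I_m -> T0),
        [/\ forall s, 0 <= w s, \sum_s w s = 1, forall s, jj (iota (e s)) = jj a
          & forall i, (b a i)%:R = \sum_s w s * (b (iota (e s)) i)%:R],
      forall a, a \notin codom iota -> p (inl a) = 0
    & ml_generic (fun a => jj (iota a)) (fun a => b (iota a))
        (fun a => p (inl (iota a))) (fun i => p (inr i))].

Lemma generic_on_stable (T0 : finType) (iota : T0 -> T) p : generic_on iota p ->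
  forall F : set_system nat, UltraFilter F -> (forall N, F [set m | (N <= m)%N]) ->
  forall pm : nat -> V -> C, (forall v, ulim F (fun m => pm m v) (p v)) ->
  \forall m \near F, (ml_set_at (pm m) #= ml_set_at p)%card.
Proof.
move=> [iota_inj iota_onto hull off gen] F FU Fcof pm pmP.
exact: (ml_set_card_stable Fcof iota_inj iota_onto hull off gen).
Qed.

Lemma ml_generic_on_id p : (forall j, exists a, jj a = j) ->
  ml_generic jj b (fun a => p (inl a)) (fun i => p (inr i)) -> generic_on id p.
Proof.
move=> onto gen; split=> //.
  move=> a; exists 1%N, (fun=> 1), (fun=> a); split=> // [|i].
    by rewrite big_ord1.
  by rewrite big_ord1 mul1r.
by move=> a; rewrite (codom_f id a).
Qed.

Section Path.
Variables (p q r : V -> C) (y : R).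

(** The quadratic term keeps the values [p] at 0 and [q] at 1 but leaves the value at 1/2 free, so
    that the curve can be kept from lying in the bad hypersurface. *)
Definition path_poly (v : V) : {poly C} :=
  (1 - 'X) * (p v)%:P + 'X * (q v)%:P + 'X * (1 - 'X) * (r v)%:P.

(** Arcs from 0 to 1 in the complex plane, pairwise disjoint except at their ends as [y] varies; all
    but finitely many have no bad time in their interior. *)
Definition path_time (s : R) : C := real_complex R s + 'i%C * real_complex R (y * s * (1 - s)).

Definition path_point (s : R) (v : V) : C := (path_poly v).[path_time s].

Lemma path_pointE s v : path_point s v = (1 - path_time s) * p v + path_time s * q v
  + path_time s * (1 - path_time s) * r v.
Proof. by rewrite /path_point /path_poly !hornerE. Qed.

Lemma path_point0 : path_point 0 = p.
Proof.
apply/funext => v; rewrite path_pointE /path_time mulr0 mul0r !rmorph0 mulr0 addr0.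
by ring.
Qed.

Lemma path_point1 : path_point 1 = q.
Proof.
apply/funext => v; rewrite path_pointE /path_time subrr mulr0 rmorph0 rmorph1 mulr0 addr0.
by ring.
Qed.

Lemma path_point_lim (F : set_system nat) (FU : UltraFilter F) (s : nat -> R) (s0 : R) :
  ulim F s s0 -> forall v, ulim F (fun m => path_point (s m) v) (path_point s0 v).
Proof.
move=> sP v; have tP : ulim F (fun m => path_time (s m)) (path_time s0).
  apply: ulimD; first exact: ulim_real_complex.
  apply: ulimM; first exact: ulim_cst.
  apply: ulim_real_complex; apply: ulimM; first by apply: ulimM => //; exact: ulim_cst.
  by apply: ulimB => //; exact: ulim_cst.
have t1P : ulim F (fun m => 1 - path_time (s m)) (1 - path_time s0).
  by apply: ulimB => //; exact: ulim_cst.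
rewrite path_pointE; apply: (@ulim_ext _ _ _ (fun m => (1 - path_time (s m)) * p v + path_time (s m) * q v
  + path_time (s m) * (1 - path_time (s m)) * r v)).
  by move=> m; rewrite path_pointE.
apply: ulimD; first by apply: ulimD; apply: ulimM => //; exact: ulim_cst.
by apply: ulimM; [exact: ulimM|exact: ulim_cst].
Qed.

Lemma path_time_inj (s : R) (rho : C) : 0 < s < 1 -> path_time s = rho ->
  y = complex.Im rho / (complex.Re rho * (1 - complex.Re rho)).
Proof.
move=> /andP[s0 s1] <-.
have -> : path_time s = Complex s (y * s * (1 - s)).
  by rewrite [RHS]complexE.
by rewrite /= -(mulrA y) mulfK // mulf_neq0 ?lt0r_neq0 ?subr_gt0.
Qed.
End Path.

Theorem ml_set_deformation (TA TB : finType) (iA : TA -> T) (iB : TB -> T) (p q : V -> C) :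
  generic_on iA p -> generic_on iB q -> (ml_set_at p #= ml_set_at q)%card.
Proof.
move=> genp genq.
have onto j : exists a, jj a = j.
  by case: genp => _ /(_ j)[a ja] _ _ _; exists (iA a).
have [h h0 hP] := generic_polynomial R b onto.
have [ph phP] := mpoly_nonvanishing h0.
(* Solves for the curve to pass at time 1/2 through [ph], where [h] does not vanish. *)
pose r v := 4 * ph (enum_rank v) - 2 * p v - 2 * q v.
pose H : {poly C} := mmap (@polyC C) (fun l => path_poly p q r (enum_val l)) h.
have HE t : H.[t] = at_ (fun v => (path_poly p q r v).[t]) h by rewrite /H horner_mmap.
have H0 : H != 0.
  apply: contraNneq phP => HN; apply/eqP; have := HE 2^-1; rewrite HN horner0 => ->.
  by apply: meval_eq => l; rewrite /path_poly !hornerE /r enum_valK; field.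
have [rs rsP] := closed_field_poly_normal H.
(* Each root of [H] is interior to at most one arc, the one with this [y]. A root with real part 0
   or 1 gives the value 0 by the convention on division; it only excludes [y = 0]. *)
pose ys := [seq complex.Im rho / (complex.Re rho * (1 - complex.Re rho)) | rho <- rs].
have [|y yP] := @poly_nonroot R (\prod_(z <- ys) ('X - z%:P)).
  by rewrite monic_neq0 // monic_prod_XsubC.
have yys : y \notin ys by rewrite -root_prod_XsubC.
have generic_inside s : 0 < s < 1 -> generic_on id (path_point p q r y s).
  move=> s01; apply: ml_generic_on_id => //.
  suff : at_ (path_point p q r y s) h != 0 by move=> /hP[].
  rewrite -HE rsP hornerZ mulf_neq0 ?lead_coef_eq0 //.
  rewrite -[_ == 0]/(root _ _) root_prod_XsubC; apply: contra yys => ts.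
  have yE := path_time_inj s01 (erefl (path_time y s)).
  by rewrite {1}yE; apply: map_f.
pose P s := (ml_set_at (path_point p q r y s) #= ml_set_at p)%card : Prop.
rewrite card_eq_sym -[q](path_point1 p q r y); apply: (unit_interval_connected (P := P)); last first.
  by rewrite /P path_point0; exact: card_eqxx.
move=> s /andP[s0 s1]; apply: contrapT => neq.
have [F FU Fcof] := nonprincipal_ultrafilter.
have FP : ProperFilter F := ultra_proper.
have /choice[sm smP] (m : nat) : exists s', [/\ 0 <= s' <= 1, `|s' - s| < m.+1%:R^-1 & ~ (P s' <-> P s)].
  apply: contrapT => Hm; apply: neq; exists m.+1%:R^-1; first by rewrite invr_gt0.
  by move=> s' s'01 s's; apply: contrapT => nP; apply: Hm; exists s'.
have sm_lim : ulim F sm s.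
  move=> e e0; have He : 0 < real_complex R e by rewrite -[0]/(real_complex R 0) ltcR.
  apply: filterS (ulim_harmonic Fcof He) => m; rewrite subr0 normc_real_complex ltcR ger0_norm ?invr_ge0 //.
  by apply: lt_trans; have [] := smP m.
have pt_lim := path_point_lim p q r y FU sm_lim.
(* The endpoints are generic for the supports given by [iA] and [iB], the interior points for all of
   [T]; stability holds in each case under perturbation by every monomial of [T]. *)
have card_near : \forall m \near F,
    (ml_set_at (path_point p q r y (sm m)) #= ml_set_at (path_point p q r y s))%card.
  have [s_eq0|s_neq0] := eqVneq s 0.
    by move: pt_lim; rewrite s_eq0 path_point0; exact: (generic_on_stable genp).
  have [s_eq1|s_neq1] := eqVneq s 1.
    by move: pt_lim; rewrite s_eq1 path_point1; exact: (generic_on_stable genq).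
  apply: (generic_on_stable (generic_inside s _)) => //.
  by rewrite !lt_neqAle s0 s1 eq_sym s_neq0 s_neq1.
have [m Hm] := filter_ex card_near.
have [_ _ []] := smP m; rewrite /P; split=> E; first exact: card_eq_trans (card_esym Hm) E.
exact: card_eq_trans Hm E.
Qed.

End Deformation.

(** * Sparse systems *)

Section ZariskiPrincipal.
Variables (C : numFieldType) (I : finType).

Lemma zariski_open_neq0 (h : {mpoly C[#|I|]}) :
  zariski_open [set p : {ffun I -> C} | eval_at p h != 0].
Proof.
exists [set h]; apply/seteqP; split=> p /=.
  by move=> hp /(_ h erefl) h0; rewrite h0 eqxx in hp.
by move=> H; apply/eqP => h0; apply: H => _ ->.
Qed.

Lemma zariski_dense_neq0 (h : {mpoly C[#|I|]}) : h != 0 ->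
  zariski_dense [set p : {ffun I -> C} | eval_at p h != 0].
Proof.
move=> h0 _ [S ->] [p0 /= /existsNP[P /not_implyP[SP Pp0]]].
have P0 : P != 0 by apply/eqP => P0; apply: Pp0; rewrite P0 /eval_at meval0.
have [q] := mpoly_nonvanishing (mulf_neq0 P0 h0).
rewrite mevalM mulf_eq0 negb_or => /andP[Pq hq].
pose p : {ffun I -> C} := [ffun v => q (enum_rank v)].
have pE Q : eval_at p Q = Q.@[q].
  by apply: meval_eq => l; rewrite ffunE enum_valK.
exists p; split=> /=; last by rewrite pE.
by move=> /(_ P SP) /eqP; rewrite pE (negbTE Pq).
Qed.

End ZariskiPrincipal.

Section SparseML.
Variables (R : realType) (n k : nat).
Local Notation C := R[i].
Implicit Types A B : supports n k.

Definition row_of A (t : coef_index A) : 'I_k := tag t.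
Definition exp_of A (t : coef_index A) (i : 'I_n) : nat := (val (tagged t)) i.

Lemma sum_coef_index A (j : 'I_k) (f : coef_index A -> C) :
  \sum_(t | row_of t == j) f t = \sum_(a : A j) f (Tagged (fun j => A j) a).
Proof.
have H : \sum_(i | i == j) \sum_(a : A i) f (Tagged (fun j => A j) a) =
    \sum_(t : coef_index A | (tag t == j) && true) f (Tagged (fun j => A j) (tagged t)).
  exact: (sig_big_dep _ (fun=> xpredT)).
rewrite big_pred1_eq in H; rewrite H; apply: eq_big => [t|t _]; first by rewrite andbT.
by rewrite -{1}[t]taggedK.
Qed.

Lemma sparse_system_eval A (c : {ffun coef_index A -> C}) x j :
  (sparse_system c j).@[x] = \sum_(t | row_of t == j) c t * monom (@exp_of A) x t.
Proof.
rewrite sum_coef_index /sparse_system raddf_sum; apply: eq_bigr => a _ /=.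
by rewrite mevalZ mevalX.
Qed.

Lemma sparse_system_mderiv A (c : {ffun coef_index A -> C}) x j i :
  x i * ((sparse_system c j)^`M(i)).@[x] =
  \sum_(t | row_of t == j) c t * monom (@exp_of A) x t * (exp_of t i)%:R.
Proof.
rewrite sum_coef_index /sparse_system.
have -> : (\sum_(a : A j) c (Tagged (fun j => A j) a) *: 'X_[val a])^`M(i) =
    \sum_(a : A j) (c (Tagged (fun j => A j) a) *: 'X_[val a])^`M(i) by exact: raddf_sum.
rewrite raddf_sum mulr_sumr; apply: eq_bigr => a _ /=.
rewrite mderivZ mevalZ mulrCA -mulrA; congr (_ * _).
transitivity (('X_i * ('X_[val a])^`M(i)).@[x]); first by rewrite mevalM mevalXU.
by rewrite mul_mderivX mevalZ mevalX mulrC.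
Qed.

Lemma ML_solutionsE A (c : {ffun coef_index A -> C}) (u : {ffun 'I_n -> C}) :
  ML_solutions (sparse_system c) u = ml_set (@row_of A) (@exp_of A) c u.
Proof.
have E (x : {ffun 'I_n -> C}) (lam : {ffun 'I_k -> C}) i :
    x i * \sum_(j < k) lam j * ((sparse_system c j)^`M(i)).@[x] =
    \sum_t lam (row_of t) * (c t * monom (@exp_of A) x t) * (exp_of t i)%:R.
  rewrite mulr_sumr [RHS](partition_big (@row_of A) xpredT) //=; apply: eq_bigr => j _.
  rewrite mulrCA sparse_system_mderiv mulr_sumr; apply: eq_bigr => t /eqP <-.
  ring.
apply/seteqP; split=> -[x lam] /= [solu solf]; split=> [i|j].
- by have /eqP := solu i; rewrite subr_eq0 E => /eqP.
- by rewrite -(sparse_system_eval c x j) solf.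
- by rewrite E solu subrr.
- by rewrite sparse_system_eval; exact: solf.
Qed.

Lemma sparse_system_mcoeff A (c : {ffun coef_index A -> C}) (t : coef_index A) :
  (sparse_system c (row_of t))@_(val (tagged t)) = c t.
Proof.
rewrite /sparse_system raddf_sum (bigD1 (tagged t)) //= mcoeffZ mcoeffX eqxx mulr1.
rewrite taggedK big1 ?addr0 // => a at_neq.
by rewrite mcoeffZ mcoeffX (inj_eq val_inj) (negbTE at_neq) mulr0.
Qed.

Lemma sparse_system_mcoeff0 A (c : {ffun coef_index A -> C}) j m :
  m \notin A j -> (sparse_system c j)@_m = 0.
Proof.
move=> mA; rewrite /sparse_system raddf_sum big1 // => a _ /=.
rewrite mcoeffZ mcoeffX; case: eqP => [am|_]; last by rewrite mulr0.
by rewrite -am (valP a) in mA.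
Qed.

Lemma coef_index_inj A (t t' : coef_index A) :
  row_of t = row_of t' -> val (tagged t) = val (tagged t') -> t = t'.
Proof.
case: t t' => [j a] [j' a']; rewrite /row_of /= => jj'; case: j' / jj' a' => a' /val_inj -> //.
Qed.

Section Enlarge.
Variables (A B : supports n k).
Hypothesis AB : forall j, (A j `<=` B j)%fset.

Definition enlarge (t : coef_index A) : coef_index B :=
  Tagged (fun j => B j) (fincl (AB (tag t)) (tagged t)).

Lemma enlarge_val t : val (tagged (enlarge t)) = val (tagged t). Proof. by []. Qed.

Lemma enlarge_inj : injective enlarge.
Proof.
move=> t t' E; apply: coef_index_inj; first by rewrite /row_of -[tag t]/(tag (enlarge t)) E.
by rewrite -enlarge_val E.
Qed.

Lemma enlarge_codom (t : coef_index B) : (t \in codom enlarge) = (val (tagged t) \in A (tag t)).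
Proof.
apply/codomP/idP => [[t0 ->]|tA]; first by rewrite enlarge_val; exact: valP.
by exists (Tagged (fun j => A j) [` tA]%fset); apply: coef_index_inj.
Qed.

(** Reading the coefficients off the polynomial itself gives 0 at the monomials outside [A] without
    a case distinction. *)
Definition extend (p : {ffun coef_index A + 'I_n -> C}) : {ffun coef_index B + 'I_n -> C} :=
  [ffun v => match v with
    | inl t => (sparse_system (coefs_of p) (row_of t))@_(val (tagged t))
    | inr i => p (inr i) end].

Lemma extend_enlarge p t : extend p (inl (enlarge t)) = p (inl t).
Proof. by rewrite ffunE enlarge_val (sparse_system_mcoeff (coefs_of p) t) ffunE. Qed.

Lemma sparse_system_extend p :
  sparse_system (coefs_of (extend p)) = sparse_system (coefs_of p).
Proof.
apply/funext => j; apply/mpolyP => m.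
have [mB|mB] := boolP (m \in B j).
  pose t : coef_index B := Tagged (fun j => B j) [` mB]%fset.
  by have := sparse_system_mcoeff (coefs_of (extend p)) t; rewrite !ffunE.
rewrite !sparse_system_mcoeff0 //; apply: contra mB; exact/fsubsetP.
Qed.

Lemma data_of_extend p : data_of (extend p) = data_of p.
Proof. by apply/ffunP => i; rewrite !ffunE. Qed.

End Enlarge.

Lemma msupp_in_Newt A (p : {ffun coef_index A + 'I_n -> C}) j m : (forall v, p v != 0) ->
  m \in A j -> exponent_vector R m \in Newt (sparse_system (coefs_of p) j).
Proof.
move=> p0 mA; apply/mem_set; exists 1%N, (fun=> 1), (fun=> exponent_vector R m); split.
- by move=> _; exact: ler01.
- by rewrite big_ord1.
- move=> _; exists m => //=; rewrite mcoeff_msupp.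
  pose t : coef_index A := Tagged (fun j => A j) [` mA]%fset.
  by have -> := sparse_system_mcoeff (coefs_of p) t; rewrite ffunE p0.
by rewrite big_ord1 scale1r.
Qed.

Lemma Newt_hull A (p : {ffun coef_index A + 'I_n -> C}) j (m : 'X_{1..n}) :
  Newt (sparse_system (coefs_of p) j) (exponent_vector R m) ->
  exists (s : nat) (w : 'I_s -> R) (e : 'I_s -> coef_index A),
    [/\ forall i, 0 <= w i, \sum_i w i = 1, forall i, row_of (e i) = j
      & forall i, (m i)%:R = \sum_t w t * (exp_of (e t) i)%:R].
Proof.
move=> [s [w [v [w0 w1 vP mE]]]].
have /choice[e eP] t : exists e : coef_index A, row_of e = j /\
    forall i, v t 0 i = (exp_of e i)%:R.
  have [m' /= m'S m'v] := vP t; have [m'A|m'A] := boolP (m' \in A j).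
    exists (Tagged (fun j => A j) [` m'A]%fset); split=> // i.
    by rewrite -m'v mxE.
  by move: m'S; rewrite mcoeff_msupp sparse_system_mcoeff0 ?eqxx.
exists s, w, e; split=> // [t|i]; first exact: (eP t).1.
have := congr1 (fun y : 'rV[R]_n => y 0 i) mE; rewrite mxE => ->.
by rewrite summxE; apply: eq_bigr => t _; rewrite mxE (eP t).2.
Qed.

(** The nonemptiness of the supports sits inside the conclusion, so that one polynomial can be
    chosen for every [A]; when it fails, the constant 1 is taken. *)
Lemma generic_condition A : exists h : {mpoly C[#|{: coef_index A + 'I_n}|]}, h != 0 /\
  ((forall j, A j != fset0) -> forall p : coef_index A + 'I_n -> C,
    h.@[fun l => p (enum_val l)] != 0 -> (forall v, p v != 0) /\
    ml_generic (@row_of A) (@exp_of A) (fun a => p (inl a)) (fun i => p (inr i))).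
Proof.
have [A0|nA0] := pselect (forall j, A j != fset0); last first.
  by exists 1; rewrite oner_eq0; split=> // /nA0.
have [|h h0 hP] := @generic_polynomial R _ n k (@row_of A) (@exp_of A); last by exists h.
move=> j; have /fset0Pn[a aA] := A0 j.
by exists (Tagged (fun j => A j) [` aA]%fset).
Qed.

Definition generic_poly A : {mpoly C[#|{: coef_index A + 'I_n}|]} :=
  projT1 (cid (generic_condition A)).

Definition generic_set A : set {ffun coef_index A + 'I_n -> C} :=
  [set p | eval_at p (generic_poly A) != 0].

Arguments generic_set : clear implicits.

Lemma generic_poly_neq0 A : generic_poly A != 0.
Proof. by rewrite /generic_poly; case: cid => h []. Qed.

Lemma generic_setP A p : (forall j, A j != fset0) -> generic_set A p ->
  (forall v, p v != 0) /\
  ml_generic (@row_of A) (@exp_of A) (fun a => p (inl a)) (fun i => p (inr i)).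
Proof.
by move=> A0 Up; have [_ H] := projT2 (cid (generic_condition A)); exact: H A0 p Up.
Qed.

Lemma generic_on_extend A B (AB : forall j, (A j `<=` B j)%fset)
    (p : {ffun coef_index A + 'I_n -> C}) : (forall j, A j != fset0) ->
  generic_set A p ->
  (forall j m, m \in B j -> Newt (sparse_system (coefs_of p) j) (exponent_vector R m)) ->
  generic_on (@row_of B) (@exp_of B) (enlarge AB) (extend B p).
Proof.
move=> A0 Up hull; have [p0 gen] := generic_setP A0 Up; split.
- exact: enlarge_inj.
- move=> j; have /fset0Pn[a aA] := A0 j.
  by exists (Tagged (fun j => A j) [` aA]%fset).
- move=> t; have [s [w [e [w0 w1 ej eE]]]] := Newt_hull (hull _ _ (valP (tagged t))).
  by exists s, w, e.
- move=> t; rewrite enlarge_codom => tA.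
  by rewrite ffunE sparse_system_mcoeff0.
have -> : (fun a => extend B p (inl (enlarge AB a))) = (fun a => p (inl a)).
  by apply/funext => a; rewrite extend_enlarge.
by have -> : (fun i => extend B p (inr i)) = (fun i => p (inr i)) by apply/funext => i; rewrite ffunE.
Qed.

Lemma ML_solutions_extend A B (p : {ffun coef_index A + 'I_n -> C}) :
  (forall j, (A j `<=` B j)%fset) ->
  ML_solutions (sparse_system (coefs_of p)) (data_of p) =
  ml_set_at (@row_of B) (@exp_of B) (extend B p).
Proof.
move=> AB; rewrite -(sparse_system_extend AB) -(data_of_extend B) ML_solutionsE /ml_set_at.
by congr ml_set; apply/funext => a; rewrite ffunE.
Qed.

Theorem ML_solutions_card_eq A B : (forall j, A j != fset0) -> (forall j, B j != fset0) ->
  forall p q, generic_set A p -> generic_set B q ->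
  (forall j, Newt (sparse_system (coefs_of p) j) = Newt (sparse_system (coefs_of q) j)) ->
  (ML_solutions (sparse_system (coefs_of p)) (data_of p) #=
   ML_solutions (sparse_system (coefs_of q)) (data_of q))%card.
Proof.
move=> A0 B0 p q Up Uq NE; pose D : supports n k := fun j => (A j `|` B j)%fset.
have AD j : (A j `<=` D j)%fset by exact: fsubsetUl.
have BD j : (B j `<=` D j)%fset by exact: fsubsetUr.
have [p0 _] := generic_setP A0 Up; have [q0 _] := generic_setP B0 Uq.
(* All coefficients being nonzero, every exponent of [A j] or [B j] lies in the common polytope. *)
have hull j m : m \in D j -> Newt (sparse_system (coefs_of p) j) (exponent_vector R m).
  rewrite inE => /orP[mA|mB]; apply/set_mem; first exact: msupp_in_Newt.
  by rewrite NE; exact: msupp_in_Newt.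
rewrite (ML_solutions_extend p AD) (ML_solutions_extend q BD).
apply: (ml_set_deformation (generic_on_extend AD A0 Up hull)).
by apply: (generic_on_extend BD B0 Uq) => j m mD; rewrite -NE; exact: hull.
Qed.

Lemma ML_solutions_finite A p : (forall j, A j != fset0) -> generic_set A p ->
  finite_set (ML_solutions (sparse_system (coefs_of p)) (data_of p)).
Proof.
move=> A0 Up; have AA j : (A j `<=` A j)%fset by exact: fsubset_refl.
have [p0 _] := generic_setP A0 Up.
have [|iota_inj onto hull off gen] := generic_on_extend AA A0 Up.
  by move=> j m mA; apply/set_mem; exact: msupp_in_Newt.
have [F FU Fcof] := nonprincipal_ultrafilter.
rewrite (ML_solutions_extend p AA).
exact: (ml_set_finite Fcof iota_inj onto hull off gen).
Qed.

Definition with_data A (p : {ffun coef_index A + 'I_n -> C}) (u : {ffun 'I_n -> C}) :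
    {ffun coef_index A + 'I_n -> C} :=
  [ffun v => match v with inl a => p (inl a) | inr i => u i end].

Lemma coefs_of_with_data A p u : coefs_of (with_data p u) = coefs_of p :> {ffun coef_index A -> C}.
Proof. by apply/ffunP => a; rewrite !ffunE. Qed.

Lemma data_of_with_data A (p : {ffun coef_index A + 'I_n -> C}) u : data_of (with_data p u) = u.
Proof. by apply/ffunP => i; rewrite !ffunE. Qed.

(** Freezing the coefficients of [p] turns the generic polynomial into a polynomial in [u], nonzero
    since its value at the data of [p] is. *)
Lemma generic_data A (p : {ffun coef_index A + 'I_n -> C}) : generic_set A p ->
  zariski_open [set u | generic_set A (with_data p u)] /\
  zariski_dense [set u | generic_set A (with_data p u)].
Proof.
move=> Up; pose h : {mpoly C[#|'I_n|]} := generic_poly A \mPo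
  [tuple (match enum_val l with inl a => (p (inl a))%:MP | inr i => 'X_(enum_rank i) end)
   | l < #|{: coef_index A + 'I_n}|].
have hE u : eval_at u h = eval_at (with_data p u) (generic_poly A).
  rewrite /eval_at /h comp_mpoly_meval; apply: meval_eq => l.
  rewrite tnth_mktuple ffunE; case: (enum_val l) => [a|i]; first by rewrite mevalC.
  by rewrite mevalXU enum_rankK.
have -> : [set u | generic_set A (with_data p u)] = [set u | eval_at u h != 0].
  by apply/seteqP; split=> u /=; rewrite /generic_set /= hE.
split; first exact: zariski_open_neq0.
apply: zariski_dense_neq0; apply/eqP => h0.
have pE : with_data p (data_of p) = p.
  by apply/ffunP => -[a|i]; rewrite !ffunE.
have := hE (data_of p); rewrite pE h0 [LHS]meval0 => p0.
by move/eqP: Up; apply; rewrite -p0.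
Qed.

(** Independence of [u] is again the deformation theorem, applied to one system with two data
    vectors, where the polytopes agree trivially. *)
Lemma is_ML_degree_generic A p m : (forall j, A j != fset0) -> generic_set A p ->
  (ML_solutions (sparse_system (coefs_of p)) (data_of p) #= `I_m)%card ->
  is_ML_degree (sparse_system (coefs_of p)) m.
Proof.
move=> A0 Up pm; have [Wo Wd] := generic_data Up.
exists [set u | generic_set A (with_data p u)]; split=> // u /= Uu.
apply: card_eq_trans pm.
have := @ML_solutions_card_eq A A A0 A0 (with_data p u) p Uu Up.
by rewrite coefs_of_with_data data_of_with_data; apply.
Qed.

End SparseML.

Theorem corollary2p16 (R : realType) (n k : nat) (hn : (0 < n)%N) (hk : (0 < k)%N) :
  exists U : forall A : supports n k, set {ffun coef_index A + 'I_n -> R[i]},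
    (forall A : supports n k, (forall j, A j != fset0) ->
       zariski_open (U A) /\ zariski_dense (U A)) /\
    (forall A B : supports n k,
       (forall j, A j != fset0) -> (forall j, B j != fset0) ->
       forall (p : {ffun coef_index A + 'I_n -> R[i]})
              (q : {ffun coef_index B + 'I_n -> R[i]}),
       U A p -> U B q ->
       let f := sparse_system (coefs_of p) in
       let g := sparse_system (coefs_of q) in
       (forall j, Newt (f j) = Newt (g j)) ->
       exists m : nat,
         [/\ is_ML_degree f m, is_ML_degree g m,
             (ML_solutions f (data_of p) #= `I_m)%card
           & (ML_solutions g (data_of q) #= `I_m)%card]).
Proof.
exists (@generic_set R n k); split=> [A A0|A B A0 B0 p q Up Uq f g NE].
  split; first exact: zariski_open_neq0.
  by apply: zariski_dense_neq0; exact: generic_poly_neq0.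
have /finite_setP[m fm] := ML_solutions_finite A0 Up.
have gm : (ML_solutions g (data_of q) #= `I_m)%card.
  by apply: card_eq_trans fm; apply: card_esym; exact: ML_solutions_card_eq.
exists m; split=> //; exact: is_ML_degree_generic.
Qed.
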